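(* Let $C_0,C_1,C_2$ be the constants of the following fact: for the Square-Root SLOPE estimator $\hat\beta$ (with $A\ge16+4\sqrt2$), for all $\delta\in(0,1]$ and $n_1>\frac{C_0}{\delta^2}s\log(\frac{ep}{s})$, $\sup_{|\beta|_0\le s}\mathbf P_\beta(\|\hat\beta-\beta\|\ge\delta\sigma)\le C_1(\frac{s}{2p})^{C_2s}$. Let $s\le p/2$, $a\le\sigma$, $\delta\in(0,1]$, and assume $$n_1>\frac{C_0}{\delta^2}s\log\Big(\frac{ep}{s}\Big),\qquad n_2\ge\frac{4\sigma^2\log(\frac ps-1)}{a^2}.$$ Let $\hat\eta$ be the selector defined below with threshold $t=t_{\sigma\sqrt{1+\delta^2}}$. Then $$\sup_{\beta\in\Omega^p_{s,a}}\mathbf E_\beta|\hat\eta-\eta_\beta|\le2\sqrt{s(p-s)}\exp\Big(-\frac{n_2}{2}\log\Big(1+\frac{a^2}{4\sigma^2(1+\delta^2)}\Big)\Big)+se^{-n_2/24}+C_1p\Big(\frac{s}{2p}\Big)^{C_2s},$$ $$\sup_{\beta\in\Omega^p_{s,a}}\mathbf P_\beta(\hat\eta\neq\eta_\beta)\le2\sqrt{s(p-s)}\exp\Big(-\frac{n_2}{2}\log\Big(1+\frac{a^2}{4\sigma^2(1+\delta^2)}\Big)\Big)+se^{-n_2/24}+C_1\Big(\frac{s}{2p}\Big)^{C_2s}.$$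
   Context: Model: $Y=X\beta+\sigma\xi\in\mathbb{R}^n$, $X\in\mathbb{R}^{n\times p}$ with i.i.d. $\mathcal N(0,1)$ entries, $\xi\sim\mathcal N(0,\mathbb I_n)$ independent of $X$, $\sigma>0$. $\Omega^p_{s,a}=\{\beta\in\mathbb{R}^p:|\beta|_0\le s,\ |\beta_i|\ge a \text{ whenever }\beta_i\ne0\}$, $\eta_\beta=(\mathbf 1\{\beta_i\neq0\})_{i\le p}$, $|\cdot|$ Hamming distance. The sample is split into disjoint subsamples $(X^{(1)},Y^{(1)})$ of size $n_1$ and $(X^{(2)},Y^{(2)})$ of size $n_2$, $n=n_1+n_2$. $\hat\beta$ is the Square-Root SLOPE estimator on the first subsample: $\hat\beta\in\arg\min_\beta\big(\|Y^{(1)}-X^{(1)}\beta\|/\sqrt{n_1}+2\sum_{j}\lambda_j\beta^*_j\big)$ with $\lambda_j=A\sqrt{\log(2p/j)/n}$ and $\beta^*_1\ge\dots\ge\beta^*_p$ the sorted $|\beta_i|$. The selector: $\hat\eta_i=\mathbf 1\Big\{\frac{|X_i^{(2)\top}(Y^{(2)}-\sum_{j\neq i}X^{(2)}_j\hat\beta_j)|}{\|X^{(2)}_i\|}>t(X^{(2)}_i)\Big\}$, $i=1,\dots,p$, where $X^{(2)}_i$ is the $i$th column of $X^{(2)}$. For $\sigma'>0$, $t_{\sigma'}(u)=\frac{a\|u\|}{2}+\frac{\sigma'^2\log(\frac ps-1)}{a\|u\|}$, $u\in\mathbb{R}^{n_2}$. *)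

(* Defs.v *)
From HB Require Import structures.
From mathcomp Require Import all_boot all_order all_algebra.
From mathcomp Require Import all_classical all_reals.
From mathcomp Require Import ereal topology normedtype sequences exp measure
  lebesgue_measure lebesgue_integral probability normal_distribution.

Unset Printing Implicit Defensive.
Import Order.TTheory GRing.Theory Num.Theory.
Local Open Scope classical_set_scope.
Local Open Scope ring_scope.

Section Defs.
Context {R : realType}.

Definition enorm {m : nat} (v : 'cV[R]_m) : R :=
  Num.sqrt (\sum_(k < m) (v k 0) ^+ 2).

Definition l0 {p : nat} (b : 'cV[R]_p) : nat := #|[set i : 'I_p | b i 0 != 0]|.

Definition support_ind {p : nat} (b : 'cV[R]_p) : 'I_p -> bool :=
  fun i => b i 0 != 0.

Definition hamming {p : nat} (e1 e2 : 'I_p -> bool) : nat :=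
  #|[set i : 'I_p | e1 i != e2 i]|.

Definition Omega (p s : nat) (a : R) : set 'cV[R]_p :=
  [set b | (l0 b <= s)%N /\ forall i, b i 0 != 0 -> a <= `|b i 0|].

Definition sorted_abs {p : nat} (b : 'cV[R]_p) : seq R :=
  sort (fun x y : R => y <= x) [seq `|b i 0| | i <- enum 'I_p].

Definition slope_lambda (A : R) (n p j : nat) : R :=
  A * Num.sqrt (ln ((2 * p)%:R / j%:R) / n%:R).

(* Square-Root SLOPE objective on the first subsample (n = n1 + n2 total). *)
Definition srslope_obj (A : R) (n : nat) {n1 p : nat}
  (X1 : 'M[R]_(n1, p)) (Y1 : 'cV[R]_n1) (b : 'cV[R]_p) : R :=
  enorm (Y1 - X1 *m b) / Num.sqrt n1%:R
  + 2 * \sum_(j < p) slope_lambda A n p j.+1 * nth 0 (sorted_abs b) j.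

Definition thr (a sigma' : R) (p s : nat) {m : nat} (u : 'cV[R]_m) : R :=
  a * enorm u / 2 + sigma' ^+ 2 * ln (p%:R / s%:R - 1) / (a * enorm u).

Definition selector (a sigma' : R) (p s : nat) {n2 : nat}
  (X2 : 'M[R]_(n2, p)) (Y2 : 'cV[R]_n2) (bh : 'cV[R]_p) : 'I_p -> bool :=
  fun i =>
    let Xi := col i X2 in
    let r := Y2 - \sum_(j < p | j != i) bh j 0 *: col j X2 in
    thr a sigma' p s Xi < `|(Xi^T *m r) 0 0| / enorm Xi.

Definition response {n p : nat} (sigma : R) (X : 'M[R]_(n, p)) (xi : 'cV[R]_n)
  (b : 'cV[R]_p) : 'cV[R]_n := X *m b + sigma *: xi.

Definition mutually_independent {d} {T : measurableType d}
  (P : probability T R) {I : finType} (Z : I -> T -> R) : Prop :=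
  (forall i, measurable_fun setT (Z i)) /\
  forall (J : {set I}) (B : I -> set R), (forall i, measurable (B i)) ->
    P (\bigcap_(i in [set i | i \in J]) (Z i @^-1` B i)) =
    (\prod_(i in J) P (Z i @^-1` B i))%E.

Definition gauss_entries {T : Type}
  {n p : nat} (X : T -> 'M[R]_(n, p)) (xi : T -> 'cV[R]_n) :
  (('I_n * 'I_p) + 'I_n)%type -> T -> R :=
  fun k w => match k with inl ij => X w ij.1 ij.2 | inr i => xi w i 0 end.

Definition std_gaussian_design {d} {T : measurableType d} (P : probability T R)
  {n p : nat} (X : T -> 'M[R]_(n, p)) (xi : T -> 'cV[R]_n) : Prop :=
  mutually_independent P (gauss_entries X xi) /\
  forall k (B : set R), measurable B ->
    P (gauss_entries X xi k @^-1` B) = normal_prob 0 1 B.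

End Defs.

(* Main.v *)
Require Import Defs.
From HB Require Import structures.
From mathcomp Require Import all_boot all_order all_algebra.
From mathcomp Require Import all_classical all_reals.
From mathcomp Require Import ereal topology normedtype sequences exp measure
  lebesgue_measure lebesgue_integral probability normal_distribution.
From mathcomp Require Import realfun measurable_realfun numfun charge.
From mathcomp Require Import ring lra.
Import Order.TTheory GRing.Theory Num.Theory.
Import numFieldNormedType.Exports.
Local Open Scope classical_set_scope.
Local Open Scope ring_scope.

(** Condition on the first subsample and let [v] be the error of the estimator.  For a
    column [u] of the second design, the test statistic is [b_i |u|] plus a centred normal
    variable of variance at most [sigma^2 + |v|^2 < sigma^2 (1 + delta^2)] on the event
    [|v| < delta sigma].  Gaussian tails at the threshold, integrated over the chi-square
    variable [|u|^2], give [((p - s) / s)^(-1/2) rho] for a false positive and half of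
    [((p - s) / s)^(1/2) rho] plus [exp (- n2 / 24)] for a false negative, where
    [rho = (1 + a^2 / (4 sigma^2 (1 + delta^2)))^(- n2 / 2)]; the last term is the chi-square
    lower tail, where the threshold exceeds the signal.  If [((p - s) / s)^(1/2) rho >= 1]
    the bound on the false negatives is trivial.

    Conditioning requires the estimator to be a Borel function of the first subsample.
    Any minimizer has this property almost surely because it is almost surely unique: by
    homogeneity of the objective, when [t] times the response is added to column [j] of the
    design, the inverse of the optimal value is a convex function of [t] whose
    subgradients are proportional to the [j]-th coordinates of the minimizers.  A
    convex function of one variable has countably many kinks, and the Gaussian law is
    quasi-invariant under these shifts. *)

(** * Product Gaussian space *)

(** The sigma-algebra of the underlying space may be larger than that generated by the data, so a
    measurable estimate is not yet a function to which Fubini's theorem applies. Countability of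
    kinks enters through rational slopes: on a line of tilts, a fixed slope is strictly separated
    from all difference quotients at one point at most, so each column and each rational number
    allow a single bad parameter, which an atomless law ignores. Tilting a column by the response
    would be circular if the response depended on that column; the noise is therefore translated by
    [X b / sigma], which reduces the response to pure noise. The optimal value itself is measurable
    as an infimum over rational grids.

    The threshold is chosen so that the tail exponents [(a |u| / 2 + e s'^2 L / (a |u|))^2 / (2
    s'^2)], with [L = log (p / s - 1)], [e = 1] for a false positive and [e = -1] for a false
    negative, differ only in the cross term [e L / 2]. This produces the two reciprocal factors
    [((p - s) / s)^(-1/2)] and [((p - s) / s)^(1/2)]. *)

Section coordinate_space.
Context {R : realType} {I : finType}.

Definition box (B : I -> set R) : set (I -> R) := [set w | forall i, B i (w i)].

Definition boxes : set (set (I -> R)) :=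
  [set A | exists B : I -> set R, (forall i, measurable (B i)) /\ A = box B].

(** A separate name for the function type, so that it can carry the sigma-algebra generated by the
    boxes. *)
Definition coords : Type := I -> R.
HB.instance Definition _ := gen_eqMixin coords.
HB.instance Definition _ := gen_choiceMixin coords.
HB.instance Definition _ := isPointed.Build coords (fun=> 0).
HB.instance Definition _ := @isMeasurable.Build (sigma_display boxes) coords
  <<s boxes >> (@sigma_algebra0 _ setT boxes) (@sigma_algebraC coords boxes)
  (@sigma_algebra_bigcup _ setT boxes).

Lemma setI_closed_boxes : setI_closed boxes.
Proof.
move=> _ _ [B [mB ->]] [C [mC ->]]; exists (fun i => B i `&` C i); split.
  by move=> i; exact: measurableI.
by apply/seteqP; split=> w /=; [case=> h1 h2 i; split | move=> h; split=> i; case: (h i)].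
Qed.

Lemma measurable_box (B : I -> set R) : (forall i, measurable (B i)) ->
  measurable (box B : set coords).
Proof. by move=> mB; apply: sub_sigma_algebra; exists B. Qed.

Lemma preimage_coord (i : I) (A : set R) :
  [set w : coords | A (w i)] = box (fun k => if k == i then A else setT).
Proof.
apply/seteqP; split=> w /=; first by move=> h k; case: eqP => // ->.
by move=> /(_ i); rewrite eqxx.
Qed.

Lemma measurable_coord (i : I) : measurable_fun setT (fun w : coords => w i).
Proof.
move=> _ A mA; rewrite setTI [_ @^-1` _]preimage_coord.
by apply: measurable_box => k; case: ifP.
Qed.

Lemma measurable_fun_coords d (T : measurableType d) (f : T -> coords) :
  (forall i, measurable_fun setT (fun t => f t i)) -> measurable_fun setT f.
Proof.
move=> mf; apply: (measurability (boxes : set (set coords))) => //.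
move=> _ [_ [B [mB ->]] <-]; rewrite setTI.
rewrite (_ : _ @^-1` _ = \bigcap_(i in setT) ((fun t => f t i) @^-1` B i)).
  apply: fin_bigcap_measurable; first exact: finite_finset.
  by move=> i _; rewrite -[_ @^-1` _]setTI; exact: mf.
by apply/seteqP; split=> t /= h i => [_|]; exact: h.
Qed.

(** Conditioning on the block [J] amounts to freezing [x] and drawing the other coordinates from an
    independent [y]; the index type need not be split. *)
Definition merge (J : {set I}) (x y : coords) : coords :=
  fun i => if i \in J then x i else y i.

Lemma measurable_merge (J : {set I}) :
  measurable_fun setT (fun z : coords * coords => merge J z.1 z.2).
Proof.
apply: measurable_fun_coords => i; rewrite /merge; case: (i \in J).
  exact: (measurableT_comp (measurable_coord i) measurable_fst).
exact: (measurableT_comp (measurable_coord i) measurable_snd).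
Qed.

(** Boxes form a generating pi-system, so this one identity determines [Q]; marginal laws come from
    boxes whose other sides are [setT]. *)
Definition iid_normal (Q : probability coords R) : Prop :=
  forall B : I -> set R, (forall i, measurable (B i)) ->
    Q (box B) = (\prod_(i : I) normal_prob 0 1 (B i))%E.

Context (Q : probability coords R) (hQ : iid_normal Q).

Lemma coord_law (i : I) (B : set R) : measurable B ->
  Q [set w | B (w i)] = normal_prob 0 1 B.
Proof.
move=> mB; rewrite preimage_coord hQ; last by move=> k; case: ifP.
rewrite (bigD1 i) //= eqxx big1 ?mule1 // => k /negbTE ->.
exact: probability_setT.
Qed.

(* Fubini's theorem for the two blocks of coordinates, [J] and its complement. *)
Lemma measure_merge2 (J : {set I}) (A : set coords) : measurable A ->
  (Q \x Q)%E [set z | A (merge J z.1 z.2)] = Q A.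
Proof.
move=> mA.
have mm := measurable_merge J.
rewrite -[LHS]/(pushforward (Q \x Q)%E (fun z : coords * coords => merge J z.1 z.2 : coords) A).
apply: (measure_unique (boxes : set (set coords)) (fun=> setT)) => //=.
- exact: setI_closed_boxes.
- by move=> _; exists (fun=> setT); split=> //; apply/seteqP; split.
- by rewrite bigcup_const //; exists 0%N.
- move=> _ [B [mB ->]]; rewrite hQ // /pushforward /=.
  rewrite (_ : _ @^-1` _ = (box (fun i => if i \in J then B i else setT) : set coords) `*`
     (box (fun i => if i \in J then setT else B i) : set coords)); last first.
    apply/seteqP; split=> -[x y] /=; rewrite /merge /box /=.
      by move=> h; split=> i; have := h i; case: ifP.
    by move=> [h1 h2] i; have := h1 i; have := h2 i; case: ifP.
  have m1 : forall i, measurable (if i \in J then B i else setT) by move=> i; case: ifP.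
  have m2 : forall i, measurable (if i \in J then setT else B i) by move=> i; case: ifP.
  rewrite product_measure1E; [|exact: measurable_box|exact: measurable_box].
  apply: (etrans (congr2 mule (hQ _ m1) (hQ _ m2))).
  rewrite -big_split /=; apply: eq_bigr => i _.
  have nT : normal_prob (0 : R) 1 setT = 1%E by exact: probability_setT.
  by case: ifP => _; rewrite nT ?mule1 ?mul1e.
- move=> k; rewrite /pushforward preimage_setT.
  have QT : Q setT = 1%E by exact: probability_setT.
  by rewrite -setXTT product_measure1E // (etrans (congr2 mule QT QT) (mule1 _)) ltry.
Qed.

Lemma measure_merge (J : {set I}) (A : set coords) : measurable A ->
  Q A = (\int[Q]_x Q [set y | A (merge J x y)])%E.
Proof.
move=> mA; rewrite -(measure_merge2 J) // /product_measure1 /=.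
apply: eq_integral => x _; rewrite /xsection /=; congr (Q _).
by apply/seteqP; split=> y /=; rewrite inE.
Qed.

End coordinate_space.
Arguments coords : clear implicits.

(** * One-dimensional normal laws *)

Section lebesgue_translation.
Context {R : realType}.
Local Notation mu := (@lebesgue_measure R).

Lemma measurable_addr (c : R) : measurable_fun setT (fun x : R => x + c).
Proof. exact: measurable_funD. Qed.

Lemma lebesgue_measure_shift (c : R) (A : set R) : measurable A ->
  mu [set x | A (x + c)] = mu A.
Proof.
move=> mA; rewrite -[LHS]/(pushforward mu ((fun x => x + c) : _ -> measurableTypeR R) A).
apply/esym; have mc := measurable_addr c.
apply: lebesgue_measure_unique => //= _ [[a b]] _ <-.
rewrite /pushforward /=.
rewrite (_ : _ @^-1` _ = `]a - c, b - c]%classic); last first.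
  by apply/seteqP; split=> x /=; rewrite !in_itv /= ltrBlDr lerBrDr.
by rewrite !lebesgue_measure_itv/= !lte_fin ltrD2r -!EFinB opprB addrA subrK.
Qed.

Lemma ge0_integral_shift (c : R) (f : R -> \bar R) :
  measurable_fun setT f -> (forall x, (0 <= f x)%E) ->
  (\int[mu]_x f (x + c)%R = \int[mu]_x f x)%E.
Proof.
move=> mf f0; have mc := measurable_addr c.
rewrite -[LHS](@ge0_integral_pushforward _ _ (measurableTypeR R) (measurableTypeR R)
  R _ mc mu setT f) //.
by apply: eq_measure_integral => A mA _; exact/lebesgue_measure_shift.
Qed.

End lebesgue_translation.

Section normal.
Context {R : realType}.
Local Notation mu := (@lebesgue_measure R).

(** The law is defined on sets by its density. Integrals of functions are reached through the
    Radon-Nikodym derivative, which agrees almost everywhere with that density since both have the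
    same integral over every measurable set. *)
Lemma integral_normal_prob (m s : R) (f : R -> \bar R) :
  measurable_fun setT f -> (forall x, (0 <= f x)%E) ->
  (\int[normal_prob m s]_x f x = \int[mu]_x (f x * (normal_pdf m s x)%:E))%E.
Proof.
move=> mf f0.
have dom := normal_prob_dominates m s.
rewrite -(Radon_Nikodym_SigmaFinite.change_of_variables dom) //.
apply: ae_eq_integral => //.
- apply: emeasurable_funM => //; apply: (measurable_int mu).
  exact: Radon_Nikodym_SigmaFinite.f_integrable.
- apply: emeasurable_funM => //; apply/measurableT_comp => //; exact: measurable_normal_pdf.
- apply: ae_eqe_mul2l; apply: integral_ae_eq => //.
  + exact: Radon_Nikodym_SigmaFinite.f_integrable.
  + by apply/measurableT_comp => //; exact: measurable_normal_pdf.
  + by move=> E _ mE; rewrite -Radon_Nikodym_SigmaFinite.f_integral.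
Qed.

(** The density vanishes nowhere, so [N] is Lebesgue null; so is its translate, and absolute
    continuity leads back to the normal law. *)
Lemma normal_prob_null_shift (c : R) (N : set R) : measurable N ->
  normal_prob 0 1 N = 0%E -> normal_prob 0 1 [set x | N (x + c)] = 0%E.
Proof.
move=> mN N0.
have muN : mu N = 0%E.
  apply: measure_negligible => //.
  have : (\int[mu]_(x in N) `|(normal_pdf 0 1 x)%:E| = 0)%E.
    rewrite -N0; apply: eq_integral => x _.
    by rewrite gee0_abs // lee_fin normal_pdf_ge0.
  move/(ae_eq_integral_abs mu mN (f := fun x => (normal_pdf 0 1 x)%:E)).
  case.
    by apply: measurable_funTS; apply/measurableT_comp => //; exact: measurable_normal_pdf.
  move=> A [mA A0 sA]; exists A; split => //; apply: subset_trans sA => x Nx /= /(_ Nx) [].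
  apply/eqP; rewrite normal_pdfE ?oner_neq0 // mulf_neq0 ?gt_eqF ?normal_peak_gt0 ?expR_gt0 //.
have mNc : measurable [set x | N (x + c)].
  by rewrite -[X in measurable X]setTI; exact: (measurable_addr c).
have := normal_prob_dominates (0 : R) 1.
move/null_content_dominatesP; apply => //.
exact: (etrans (lebesgue_measure_shift c _ mN) muN).
Qed.

Lemma ge0_integralN (f : R -> \bar R) :
  measurable_fun setT f -> (forall x, (0 <= f x)%E) ->
  (\int[mu]_x f (- x)%R = \int[mu]_x f x)%E.
Proof.
move=> mf f0; have mo : measurable_fun setT (-%R : R -> R) by exact: (@oppr_measurable R setT).
rewrite -[LHS](@ge0_integral_pushforward _ _ (measurableTypeR R) (measurableTypeR R)
  R _ mo mu setT f) //.
by apply: eq_measure_integral => A mA _; exact/lebesgue_measureN.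
Qed.

Lemma normal_pdf0E (s x : R) : s != 0 ->
  normal_pdf 0 s x = normal_peak s * expR (- x ^+ 2 / (s ^+ 2 *+ 2)).
Proof. by move=> s0; rewrite normal_pdfE // /normal_fun subr0. Qed.

Lemma normal_probE (m s : R) (A : set R) : measurable A ->
  normal_prob m s A = (\int[mu]_x (\1_A x * normal_pdf m s x)%:E)%E.
Proof.
move=> mA; rewrite /normal_prob integral_mkcond; apply: eq_integral => x _.
by rewrite patchE indicE; case: (x \in A); rewrite ?mul1r ?mul0r.
Qed.

Lemma measurable_indic_normal_pdf (m s : R) (A : set R) : measurable A ->
  measurable_fun setT (fun x => (\1_A x * normal_pdf m s x)%:E).
Proof.
move=> mA; apply/measurableT_comp => //; apply: measurable_funM.
  exact: measurable_indic.
exact: measurable_normal_pdf.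
Qed.

Lemma indic_normal_pdf_ge0 (m s : R) (A : set R) x :
  (0 <= (\1_A x * normal_pdf m s x)%:E)%E.
Proof. by rewrite lee_fin mulr_ge0 // normal_pdf_ge0. Qed.

Lemma normal_probN (s : R) (A : set R) : s != 0 -> measurable A ->
  normal_prob 0 s [set x | A (- x)] = normal_prob 0 s A.
Proof.
move=> s0 mA.
have mAN : measurable [set x | A (- x)].
  by rewrite -[X in measurable X]setTI; exact: (@oppr_measurable R setT).
rewrite !normal_probE // -[RHS]ge0_integralN.
- apply: eq_integral => x _; rewrite !normal_pdf0E // sqrrN !indicE.
  by congr ((_%:R * _)%:E); rewrite /in_mem /= /mem /in_set.
- exact: measurable_indic_normal_pdf.
- exact: indic_normal_pdf_ge0.
Qed.

Lemma normal_prob_half (s : R) : s != 0 -> normal_prob 0 s `]0, +oo[ = (2^-1)%:E.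
Proof.
move=> s0.
have e : normal_prob 0 s `]-oo, 0[ = normal_prob 0 s `]0, +oo[.
  rewrite -(@normal_probN s `]0, +oo[) //; congr (normal_prob 0 s _).
  by apply/seteqP; split => x /=; rewrite !in_itv /= ?andbT oppr_gt0.
have z : normal_prob 0 s [set 0] = 0%E.
  have := normal_prob_dominates (0 : R) s.
  by move/null_content_dominatesP; apply => //; exact: lebesgue_measure_set1.
have := @probability_setT _ _ _ (normal_prob 0 s : probability _ _).
rewrite (_ : setT = `]-oo, 0[ `|` ([set 0] `|` `]0, +oo[)); last first.
  apply/seteqP; split => x //= _; rewrite !in_itv /= ?andbT.
  by case: (ltgtP x 0) => ?; [left|right; right|right; left].
rewrite measureU //=; last 2 first.
- exact: measurableU.
- by apply/seteqP; split => x //=; rewrite !in_itv /= ?andbT => -[h [x0|h']];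
  [rewrite x0 ltxx in h|have := lt_trans h h'; rewrite ltxx].
rewrite measureU //=; last first.
  by apply/seteqP; split => x //=; rewrite !in_itv /= ?andbT => -[x0]; rewrite x0 ltxx.
rewrite z e add0e.
have : normal_prob 0 s `]0, +oo[ \is a fin_num by exact: fin_num_measure.
by move=> /fineK <-; rewrite -EFinD => -[] h; congr EFin; lra.
Qed.

(** After a shift by [t], the inequality [(x + t)^2 >= x^2 + t^2] for [x, t >= 0] compares the tail
    with the positive half-line. The factor one half is the mass of that half-line. *)
Lemma normal_prob_tail (s t : R) : 0 < s -> 0 <= t ->
  (normal_prob 0 s `[t, +oo[ <= (2^-1 * expR (- t ^+ 2 / (2 * s ^+ 2)))%:E)%E.
Proof.
move=> s0 t0; have sn0 : s != 0 by rewrite gt_eqF.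
have -> : normal_prob 0 s `[t, +oo[ = normal_prob 0 s `]t, +oo[.
  apply/esym; rewrite /normal_prob integral_itv_obnd_cbnd //.
  by apply: measurable_funTS; apply/measurableT_comp => //; exact: measurable_normal_pdf.
rewrite normal_probE // -(ge0_integral_shift t); last 2 first.
- exact: (measurable_indic_normal_pdf _ _ _ (measurable_itv _)).
- exact: indic_normal_pdf_ge0.
rewrite EFinM muleC -(normal_prob_half _ sn0) normal_probE //.
rewrite -ge0_integralZl //; last 2 first.
- exact: (measurable_indic_normal_pdf _ _ _ (measurable_itv _)).
- by move=> x _; exact: indic_normal_pdf_ge0.
apply: ge0_le_integral => //.
- by move=> x _; exact: indic_normal_pdf_ge0.
- have := measurableT_comp (measurable_indic_normal_pdf 0 s _ (measurable_itv `]t, +oo[))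
  (measurable_addr t).
  by [].
- apply: measurable_funeM; exact: (measurable_indic_normal_pdf _ _ _ (measurable_itv _)).
move=> x _; rewrite -EFinM lee_fin !indicE !mem_setE !in_itv /= !andbT.
rewrite -[t in t < _]add0r ltrD2r; case: (ltP 0 x) => x0; last by rewrite !mul0r mulr0.
rewrite !mul1r !normal_pdf0E // mulrCA ler_wpM2l ?normal_peak_ge0 // -expRD ler_expR.
rewrite -subr_ge0 (_ : _ - _ = x * t / s ^+ 2); last by field.
by rewrite divr_ge0 ?sqr_ge0 // mulr_ge0 // ltW.
Qed.

Lemma normal_peakE (s : R) : 0 < s -> normal_peak s = s^-1 * normal_peak 1.
Proof.
move=> s0; rewrite /normal_peak expr1n mul1r -mulrnAr sqrtrM ?sqr_ge0 //.
by rewrite sqrtr_sqr (gtr0_norm s0) invfM.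
Qed.

(* The substitution [1 + 2 l = s ^- 2] turns the integrand into a multiple of
   the density of [N(0, s ^+ 2)]. *)
Lemma normal_laplace_sqr (l : R) : 0 <= l ->
  (\int[normal_prob 0 1]_x (expR (- l * x ^+ 2))%:E = (Num.sqrt (1 + 2 * l))^-1%:E)%E.
Proof.
move=> l0; have l1 : 0 < 1 + 2 * l by rewrite ltr_pwDl // mulr_ge0.
set s := (Num.sqrt (1 + 2 * l))^-1.
have s0 : 0 < s by rewrite invr_gt0 sqrtr_gt0.
have s2 : s ^+ 2 = (1 + 2 * l)^-1 by rewrite exprVn sqr_sqrtr // ltW.
have mf : measurable_fun setT (fun x : R => (expR (- l * x ^+ 2))%:E).
  apply/measurableT_comp => //; apply: measurableT_comp => //.
  by apply: measurable_funM => //; exact: measurable_funX.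
clearbody s; rewrite integral_normal_prob //.
transitivity (\int[mu]_x (s%:E * (normal_pdf 0 s x)%:E))%E.
  apply: eq_integral => x _; rewrite -!EFinM; congr EFin.
  rewrite !normal_pdf0E ?oner_neq0 ?gt_eqF // (normal_peakE s) // !mulrA divff ?gt_eqF // mul1r.
  rewrite mulrAC -expRD mulrC; congr (_ * expR _).
  by rewrite s2 expr1n -(mulr_natr _^-1) invfM invrK; field.
rewrite ge0_integralZl //.
- by rewrite integral_normal_pdf mule1.
- by apply/measurableT_comp => //; exact: measurable_normal_pdf.
- by move=> x _; rewrite lee_fin normal_pdf_ge0.
- by rewrite lee_fin ltW.
Qed.

Lemma measurable_normal_pdf2 (c s : R) :
  measurable_fun setT (fun z : R * R => normal_pdf 0 s (z.2 - c * z.1)).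
Proof.
apply: (measurableT_comp (measurable_normal_pdf 0 s)).
apply: measurable_funB; first exact: measurable_snd.
by apply: measurable_funM => //; exact: measurable_fst.
Qed.

(* Completing the square in the first variable. *)
Lemma normal_pdf_mul (c s x y : R) : 0 < s -> let t := Num.sqrt (c ^+ 2 + s ^+ 2) in
  normal_pdf 0 1 x * normal_pdf 0 s (y - c * x) =
  normal_pdf 0 t y * normal_pdf (c * y / t ^+ 2) (s / t) x.
Proof.
move=> s0 t; have cs : 0 < c ^+ 2 + s ^+ 2 by rewrite ltr_wpDl ?sqr_ge0 ?exprn_gt0.
have t0 : 0 < t by rewrite sqrtr_gt0.
have t2 : t ^+ 2 = c ^+ 2 + s ^+ 2 by rewrite sqr_sqrtr // ltW.
rewrite !normal_pdf0E ?oner_neq0 ?gt_eqF // normal_pdfE ?gt_eqF ?divr_gt0 // /normal_fun.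
rewrite mulrACA -expRD [RHS]mulrACA -expRD; congr (_ * expR _).
  rewrite (normal_peakE s) // (normal_peakE t) // (normal_peakE (s / t)) ?divr_gt0 //.
  by field; rewrite !gt_eqF.
rewrite exprMn exprVn !t2 expr1n -[c ^+ 2]/(c ^+ 2) -(mulr_natr (s ^+ 2)) -(mulr_natr (c ^+ 2 +
  s ^+ 2)) -(mulr_natr (_ * _^-1)); field.
by rewrite !gt_eqF.
Qed.

(** The law of [c x + y] for independent normal [x] and [y]. After exchanging the integrals,
    [normal_pdf_mul] leaves a normal density in [x] of total mass one. *)
Lemma normal_prob_conv (c s : R) (B : set R) : 0 < s -> measurable B ->
  (\int[normal_prob 0 1]_x normal_prob 0 s [set y | B (c * x + y)%R] =
   normal_prob 0 (Num.sqrt (c ^+ 2 + s ^+ 2)) B)%E.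
Proof.
move=> s0 mB; set t := Num.sqrt _.
have mcB x : measurable [set y | B (c * x + y)].
  rewrite -[X in measurable X]setTI; apply: (measurable_funD (f := cst (c * x)) (g := id)) => //.
pose h (z : R * R) : R := normal_pdf 0 1 z.1 * (\1_B z.2 * normal_pdf 0 s (z.2 - c * z.1)).
have mh : measurable_fun setT h.
  apply: measurable_funM.
    exact: (measurableT_comp (measurable_normal_pdf 0 1) measurable_fst).
  apply: measurable_funM; last exact: measurable_normal_pdf2.
  exact: (measurableT_comp (measurable_indic mB) measurable_snd).
have h0 z : 0 <= h z by rewrite !mulr_ge0 // normal_pdf_ge0.
have sect x : (normal_prob 0 s [set y | B (c * x + y)%R] =
    \int[mu]_y (\1_B y * normal_pdf 0 s (y - c * x))%:E)%E.
  rewrite normal_probE // -[RHS](ge0_integral_shift (c * x)).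
  - by apply: eq_integral => y _; rewrite addrK !indicE; congr ((_%:R * _)%:E);
    rewrite /in_mem /= /mem /in_set /= addrC.
  - apply/measurableT_comp => //; apply: measurable_funM; first exact: measurable_indic.
    apply: (measurableT_comp (measurable_normal_pdf 0 s)).
    exact: measurable_funB.
  - by move=> y; rewrite lee_fin mulr_ge0 // normal_pdf_ge0.
transitivity (\int[mu]_x \int[mu]_y (h (x, y))%:E)%E.
  rewrite integral_normal_prob.
  - apply: eq_integral => x _; rewrite sect muleC -ge0_integralZl //.
    + apply/measurableT_comp => //; apply: measurable_funM; first exact: measurable_indic.
      apply: (measurableT_comp (measurable_normal_pdf 0 s)).
      exact: measurable_funB.
    + by move=> y _; rewrite lee_fin mulr_ge0 // normal_pdf_ge0.
    + by rewrite lee_fin normal_pdf_ge0.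
  - under eq_fun do rewrite sect.
    apply: (measurable_fun_fubini_tonelli_F (m2 := mu)
      (fun z : R * R => (\1_B z.2 * normal_pdf 0 s (z.2 - c * z.1))%:E)).
      apply/measurableT_comp => //.
      apply: measurable_funM; last exact: measurable_normal_pdf2.
      exact: (measurableT_comp (measurable_indic mB) measurable_snd).
    by move=> z; rewrite lee_fin mulr_ge0 // normal_pdf_ge0.
  - by move=> x; exact: measure_ge0.
transitivity (\int[mu]_y \int[mu]_x (h (x, y))%:E)%E.
  by apply: (@fubini_tonelli _ _ (measurableTypeR R) (measurableTypeR R) R mu mu
    (fun z => (h z)%:E)) => //; exact/measurableT_comp.
rewrite normal_probE //; apply: eq_integral => y _.
transitivity (\int[mu]_x ((\1_B y * normal_pdf 0 t y)%:E * (normal_pdf (c * y / t ^+ 2) (s / t)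
  x)%:E))%E.
  apply: eq_integral => x _; rewrite -EFinM /h /=; congr EFin.
  by rewrite mulrCA (normal_pdf_mul c s x y s0) mulrA.
rewrite ge0_integralZl //.
- by rewrite integral_normal_pdf mule1.
- by apply/measurableT_comp => //; exact: measurable_normal_pdf.
- by move=> x _; rewrite lee_fin normal_pdf_ge0.
- by rewrite lee_fin mulr_ge0 // normal_pdf_ge0.
Qed.

Lemma normal_prob_subsingleton (E : set R) : measurable E ->
  (forall x y, E x -> E y -> x = y) -> normal_prob 0 1 E = 0%E.
Proof.
move=> mE E1; have := normal_prob_dominates (0 : R) 1.
move/null_content_dominatesP; apply => //.
have [->|/set0P[x Ex]] := eqVneq E set0; first exact: measure0.
rewrite (_ : E = [set x]); first exact: lebesgue_measure_set1.
by apply/seteqP; split=> [y Ey|y ->] //=; exact: E1.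
Qed.

End normal.

(** * Independent normal coordinates *)

Section gaussian_coordinates.
Context {R : realType} {I : finType}.
Context (Q : probability (coords R I) R) (hQ : iid_normal Q).
Local Notation gamma := (normal_prob (0 : R) 1).

Definition set_coord (i : I) (r : R) (w : coords R I) : coords R I :=
  fun k => if k == i then r else w k.

Lemma measurable_set_coord (i : I) :
  measurable_fun setT (fun z : measurableTypeR R * coords R I => set_coord i z.1 z.2).
Proof.
apply: measurable_fun_coords => k; rewrite /set_coord; case: (k == i).
  exact: measurable_fst.
exact: (measurableT_comp (measurable_coord k) measurable_snd).
Qed.

Lemma set_coord_law (i : I) (A : set (coords R I)) : measurable A ->
  (gamma \x Q)%E [set z | A (set_coord i z.1 z.2)] = Q A.
Proof.
move=> mA; have mm := measurable_set_coord i.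
rewrite -[LHS]/(pushforward (gamma \x Q)%E (fun z : measurableTypeR R * coords R I =>
  set_coord i z.1 z.2) A).
have g1 : gamma setT = 1%E by exact: probability_setT.
have Q1 : Q setT = 1%E by exact: probability_setT.
apply: (measure_unique (boxes : set (set (coords R I))) (fun=> setT)) => //=.
- exact: setI_closed_boxes.
- by move=> _; exists (fun=> setT); split=> //; apply/seteqP; split.
- by rewrite bigcup_const //; exists 0%N.
- move=> _ [B [mB ->]]; rewrite hQ // /pushforward /=.
  rewrite (_ : _ @^-1` _ = B i `*`
     (box (fun k => if k == i then setT else B k) : set (coords R I))); last first.
    apply/seteqP; split=> -[x y] /=; rewrite /set_coord /box /=.
      by move=> h; split=> [|k]; [have := h i; rewrite eqxx|have := h k; case: ifP].
    by move=> [h1 h2] k; have := h2 k; case: eqP => // ->.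
  have m2 : forall k, measurable (if k == i then setT else B k) by move=> k; case: ifP.
  rewrite product_measure1E; [|exact: mB|exact: measurable_box].
  apply: (etrans (congr2 mule erefl (hQ _ m2))).
  rewrite (bigD1 i) //= eqxx g1 mul1e [RHS](bigD1 i) //=; congr (_ * _)%E.
  by apply: eq_bigr => k /negbTE ->.
- move=> k; rewrite /pushforward preimage_setT.
  by rewrite -setXTT product_measure1E // (etrans (congr2 mule g1 Q1) (mule1 _)) ltry.
Qed.

Lemma measure_set_coord1 (i : I) (A : set (coords R I)) : measurable A ->
  Q A = (\int[gamma]_r Q [set w | A (set_coord i r w)])%E.
Proof.
move=> mA; rewrite -(set_coord_law i) // /product_measure1 /=.
apply: eq_integral => x _; rewrite /xsection /=; congr (Q _).
by apply/seteqP; split=> y /=; rewrite inE.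
Qed.

Lemma integral_set_coord (i : I) (f : coords R I -> \bar R) :
  measurable_fun setT f -> (forall w, (0 <= f w)%E) ->
  (\int[Q]_w f w = \int[Q]_w \int[gamma]_r f (set_coord i r w))%E.
Proof.
move=> mf f0; have mm := measurable_set_coord i.
have mfu : measurable_fun setT (fun z : measurableTypeR R * coords R I =>
  f (set_coord i z.1 z.2)).
  exact: (measurableT_comp mf mm).
transitivity (\int[gamma]_r \int[Q]_w f (set_coord i r w))%E; last first.
  exact: (fubini_tonelli (m1 := gamma) (m2 := Q) _ mfu).
transitivity (\int[(gamma \x Q)%E]_z f (set_coord i z.1 z.2))%E; last first.
  exact: (fubini_tonelli1 (m1 := gamma) (m2 := Q) _ mfu).
transitivity (\int[pushforward (gamma \x Q)%E (fun z : measurableTypeR R * coords R I =>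
  set_coord i z.1 z.2)]_w f w)%E.
  by apply: eq_measure_integral => A mA _; exact/esym/set_coord_law.
by rewrite (ge0_integral_pushforward mm).
Qed.

Lemma measurable_coords_indic (A : set (coords R I)) : measurable A ->
  measurable_fun setT (fun w => (\1_A w)%:E : \bar R).
Proof. by move=> mA; apply/measurableT_comp => //; exact: measurable_indic. Qed.

Lemma measurable_set_coord1 (i : I) (w : coords R I) : measurable_fun setT (fun r =>
  set_coord i r w).
Proof.
apply: measurable_fun_coords => k; rewrite /set_coord; case: (k == i); first exact: measurable_id.
exact: measurable_cst.
Qed.

Lemma measure_set_coord2 (i : I) (A : set (coords R I)) : measurable A ->
  Q A = (\int[Q]_w gamma [set r | A (set_coord i r w)])%E.
Proof.
move=> mA; transitivity (\int[Q]_w (\1_A w)%:E)%E.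
  by rewrite integral_indic // setIT.
rewrite (integral_set_coord i _ (measurable_coords_indic _ mA)); last first.
  by move=> w; rewrite lee_fin.
apply: eq_integral => w _.
have mu : measurable [set r | A (set_coord i r w)].
  by rewrite -[X in measurable X]setTI; exact: (measurable_set_coord1 i w).
transitivity (\int[gamma]_r (\1_[set r | A (set_coord i r w)] r)%:E)%E.
  by apply: eq_integral => r _; rewrite !indicE; congr (_%:R%:E); rewrite /in_mem /= /mem /in_set.
by rewrite integral_indic // setIT.
Qed.

(* The standard normal law is equivalent to Lebesgue measure, so its null sets are
   translation invariant. *)
Lemma null_translate1 (i : I) (c : coords R I -> R) (A : set (coords R I)) :
  measurable_fun setT c -> (forall r w, c (set_coord i r w) = c w) ->
  measurable A -> Q A = 0%E -> Q [set w | A (set_coord i (w i + c w) w)] = 0%E.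
Proof.
move=> mc ci mA A0.
pose phi (w : coords R I) := set_coord i (w i + c w) w.
have mphi : measurable_fun setT phi.
  apply: measurable_fun_coords => k; rewrite /phi /set_coord; case: (k == i).
    by apply: measurable_funD => //; exact: measurable_coord.
  exact: measurable_coord.
have mphiA : measurable (phi @^-1` A) by rewrite -[X in measurable X]setTI; exact: mphi.
have mg B : measurable B -> measurable_fun setT (fun w => gamma [set r | B (set_coord i r w)]).
  move=> mB.
  have mB2 : measurable [set z : measurableTypeR R * coords R I | B (set_coord i z.1 z.2)].
    by rewrite -[X in measurable X]setTI; exact: measurable_set_coord.
  rewrite (_ : (fun w => _) = gamma \o ysection [set z : measurableTypeR R * coords R I | B
    (set_coord i z.1 z.2)]).
    exact: measurable_fun_ysection.
  by apply/funext => w /=; congr (normal_prob 0 1 _); apply/seteqP; split=> r;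
    rewrite /ysection /= inE.
rewrite (measure_set_coord2 i) //.
have : (\int[Q]_w `|gamma [set r | A (set_coord i r w)]| = 0)%E.
  by under eq_integral do rewrite gee0_abs ?measure_ge0 //; rewrite -measure_set_coord2.
move/(ae_eq_integral_abs Q measurableT (mg A mA)) => h.
rewrite -[RHS](integral0 Q setT); apply: ae_eq_integral => //; first exact: mg.
apply: filterS h => w /= h _; have {}h := h Logic.I.
have := normal_prob_null_shift (c w) [set r | A (set_coord i r w)].
rewrite (_ : [set r | [set r | A (set_coord i r w)] (r + c w)] =
  [set r | A (phi (set_coord i r w))]).
  apply => //; rewrite -[X in measurable X]setTI; exact: (measurable_set_coord1 i w).
apply/seteqP; split=> r /=; rewrite /phi ci (_ : set_coord i r w i = r) ?/set_coord ?eqxx //;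
  congr A;
  by apply/funext => k; rewrite /set_coord; case: (k == i).
Qed.

Definition translate (J : {set I}) (c : I -> coords R I -> R) (w : coords R I) : coords R I :=
  fun k => if k \in J then w k + c k w else w k.

Lemma measurable_translate J c : (forall k, measurable_fun setT (c k)) ->
  measurable_fun setT (translate J c).
Proof.
move=> mc; apply: measurable_fun_coords => k; rewrite /translate; case: (k \in J).
  by apply: measurable_funD => //; exact: measurable_coord.
exact: measurable_coord.
Qed.

(** The amounts depend only on coordinates outside [J], so the joint translation is a composition of
    translations of single coordinates, none of which alters the remaining amounts. *)
Lemma null_translate (J : {set I}) (c : I -> coords R I -> R) (A : set (coords R I)) :
  (forall i, measurable_fun setT (c i)) ->
  (forall i w w', (forall k, k \notin J -> w k = w' k) -> c i w = c i w') ->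
  measurable A -> Q A = 0%E ->
  Q [set w | A (translate J c w)] = 0%E.
Proof.
move=> mc ci.
suff H (s : seq I) : uniq s -> {subset s <= J} -> forall A, measurable A -> Q A = 0%E ->
    Q [set w | A (fun k => if k \in s then w k + c k w else w k)] = 0%E.
  move=> mA A0; have := H (enum J) (enum_uniq _); move=> /(_ _ A mA A0) <-; last first.
    by move=> k; rewrite mem_enum.
  congr (Q _); apply/seteqP; split=> w /=; congr A; apply/funext => k;
    by rewrite /translate mem_enum.
elim: s => [_ _|i s IH /= /andP[is_ us] sJ] {}A mA A0.
  by rewrite -[RHS]A0; congr (Q _).
have iJ : i \in J by apply: sJ; rewrite mem_head.
have sJ' : {subset s <= J} by move=> k ks; apply: sJ; rewrite in_cons ks orbT.
pose B : set (coords R I) := [set w | A (set_coord i (w i + c i w) w)].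
have cu r w : c i (set_coord i r w) = c i w.
  by apply: ci => k kJ; rewrite /set_coord; case: eqP => // ki; rewrite ki iJ in kJ.
have B0 : Q B = 0%E by exact: null_translate1.
have mB : measurable B.
  suff mphi : measurable_fun setT (fun w : coords R I => set_coord i (w i + c i w) w).
    by rewrite -[X in measurable X]setTI; exact: mphi.
  apply: measurable_fun_coords => k; rewrite /set_coord; case: (k == i);
    last exact: measurable_coord.
  by apply: measurable_funD => //; exact: measurable_coord.
rewrite -(IH us sJ' B mB B0); congr (Q _).
have ck (w : coords R I) : c i (fun k => if k \in s then w k + c k w else w k) = c i w.
  by apply: ci => k; case: ifP => // /sJ' ->.
apply/seteqP; split=> w; rewrite /B /= ck (negbTE is_); congr A; apply/funext => k;
  by rewrite /set_coord in_cons; case: eqP => // ->.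
Qed.

Lemma measurable_lincomb (s : seq I) (c : I -> R) (k : I) :
  measurable_fun setT (fun w : coords R I => w k + \sum_(j <- s) c j * w j).
Proof.
apply: measurable_funD; first exact: measurable_coord.
by apply: measurable_sum => j; apply: measurable_funM => //; exact: measurable_coord.
Qed.

(** The coefficient of [w k] is normalized to one, which keeps the variance positive at every step
    of the induction, as [normal_prob_conv] requires. *)
Lemma lincomb_law (k : I) (s : seq I) (c : I -> R) (B : set R) :
  uniq (k :: s) -> measurable B ->
  Q [set w | B (w k + \sum_(j <- s) c j * w j)] =
  normal_prob 0 (Num.sqrt (1 + \sum_(j <- s) c j ^+ 2)) B.
Proof.
elim: s B => [|j s IH] B.
  move=> _ mB; rewrite big_nil addr0 sqrtr1 -(coord_law Q hQ k) //.
  by congr (Q _); apply/seteqP; split=> w /=; rewrite big_nil addr0.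
rewrite /= in_cons negb_or => /and3P[/andP[kj ks] js us] mB.
have t0 : 0 < 1 + \sum_(j <- s) c j ^+ 2 :> R.
  by rewrite ltr_wpDr // sumr_ge0 // => i _; exact: sqr_ge0.
rewrite big_cons addrCA -[X in _ + X](@sqr_sqrtr R) ?(ltW t0) //.
rewrite -normal_prob_conv ?sqrtr_gt0 // (measure_set_coord1 j); last first.
  by rewrite -[X in measurable X]setTI; exact: measurable_lincomb.
apply: eq_integral => r _; rewrite -IH /=.
- congr (Q _); apply/seteqP; split=> w /=; rewrite big_cons /set_coord (negbTE kj) eqxx addrCA;
    congr (B (_ + (_ + _))); apply: eq_big_seq => i si;
    by case: eqP => // ij; rewrite -ij si in js.
- by rewrite ks us.
- rewrite -[X in measurable X]setTI.
  by apply: (measurable_funD (f := cst (c j * r)) (g := id)).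
Qed.

(** Positivity of [s] yields a nonzero coefficient [c k]. Division by it gives the normalized form
    of [lincomb_law]; a negative [c k] reverses the half-line, which the symmetry of the law
    repairs. *)
Lemma lincomb_tail (c : I -> R) (s t : R) : 0 < s -> s ^+ 2 = \sum_k c k ^+ 2 -> 0 <= t ->
  (Q [set w : coords R I | (t <= \sum_k c k * w k)%R] <=
    (2^-1 * expR (- t ^+ 2 / (2 * s ^+ 2)))%:E)%E.
Proof.
move=> s0 s2 t0.
have [k ck] : exists k, c k != 0.
  apply: contrapT => /forallNP h; suff : s ^+ 2 = 0 by move/eqP; rewrite sqrf_eq0 gt_eqF.
  by rewrite s2 big1 // => k _; apply/eqP; rewrite sqrf_eq0; apply/negPn/negP; exact: h.
pose l := [seq j <- enum I | j != k].
have ul : uniq (k :: l) by rewrite /= mem_filter eqxx /= filter_uniq // enum_uniq.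
have sumE (F : I -> R) : \sum_j F j = F k + \sum_(j <- l) F j.
  by rewrite (bigD1 k) //= big_filter big_enum_cond.
pose T := Num.sqrt (1 + \sum_(j <- l) (c j / c k) ^+ 2).
have sT : s = `|c k| * T.
  apply/eqP; rewrite -(@eqrXn2 _ 2) ?mulr_ge0 ?sqrtr_ge0 ?(ltW s0) //.
  rewrite exprMn sqr_sqrtr ?addr_ge0 ?sumr_ge0 //; last by move=> i _; exact: sqr_ge0.
  rewrite s2 sumE real_normK ?num_real // mulrDr mulr1 mulr_sumr; apply/eqP; congr (_ + _).
  by apply: eq_bigr => j _; rewrite expr_div_n mulrC divfK // expf_neq0.
have ck0 : 0 < `|c k| by rewrite normr_gt0.
have T0 : 0 < T by move: s0; rewrite sT pmulr_rgt0.
have law (B : set R) (mB : measurable B) := lincomb_law k l (fun j => c j / c k) B ul mB.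
have E (w : coords R I) : \sum_j c j * w j = c k * (w k + \sum_(j <- l) c j / c k * w j).
  rewrite sumE mulrDr mulr_sumr; congr (_ + _); apply: eq_bigr => j _.
  by rewrite mulrA mulrCA divff // mulr1.
pose U : set R := `[t / `|c k|, +oo[%classic.
have mU : measurable U by exact: measurable_itv.
have bound : (normal_prob 0 T U <= (2^-1 * expR (- t ^+ 2 / (2 * s ^+ 2)))%:E)%E.
  apply: le_trans (normal_prob_tail _ _ T0 (divr_ge0 t0 (ltW ck0))) _.
  rewrite lee_fin ler_wpM2l // ler_expR sT le_eqVlt; apply/orP; left; apply/eqP.
  by field; rewrite !gt_eqF.
case: (ltP 0 (c k)) => c0.
- rewrite (_ : [set w | _] = [set w | U (w k + \sum_(j <- l) c j / c k * w j)]).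
    by rewrite law //; exact: bound.
  apply/seteqP; split=> w /=; rewrite /U /= in_itv /= andbT E gtr0_norm //.
    by rewrite ler_pdivrMr // mulrC.
  by rewrite ler_pdivrMr // mulrC.
- have {}c0 : c k < 0 by rewrite lt_neqAle ck.
  rewrite (_ : [set w | _] = [set w | [set x | U (- x)] (w k + \sum_(j <- l) c j / c k * w j)]).
    by rewrite law ?normal_probN ?gt_eqF // -[X in measurable X]setTI;
      exact: (@oppr_measurable R setT).
  apply/seteqP; split=> w /=; rewrite /U /= in_itv /= andbT E ltr0_norm // invrN mulrN lerN2;
    by rewrite ler_ndivlMr // mulrC.
Qed.

(** The Laplace transform of a chi-square variable, with one coordinate integrated out at a time. It
    serves both the final rate and the lower tail. *)
Lemma expectation_expR_sqr (s : seq I) (l : R) : uniq s -> 0 <= l ->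
  (\int[Q]_w (expR (- l * \sum_(j <- s) w j ^+ 2))%:E =
   ((Num.sqrt (1 + 2 * l))^-1 ^+ size s)%:E)%E.
Proof.
move=> + l0; elim: s => [_|j s IH /= /andP[js us]].
  under eq_integral do rewrite big_nil mulr0 expR0.
  by rewrite integral_cst // mul1e expr0; exact: probability_setT.
have mf s' : measurable_fun setT (fun w : coords R I => (expR (- l * \sum_(j <- s')
  w j ^+ 2))%:E).
  apply/measurableT_comp => //; apply: measurableT_comp => //; apply: measurable_funM => //.
  by apply: measurable_sum => i; apply: measurable_funX; exact: measurable_coord.
rewrite (integral_set_coord j) //.
transitivity (\int[Q]_w ((Num.sqrt (1 + 2 * l))^-1%:E * (expR (- l * \sum_(j <- s)
  w j ^+ 2))%:E))%E.
  apply: eq_integral => w _.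
  transitivity (\int[gamma]_r ((expR (- l * \sum_(j <- s)
    w j ^+ 2))%:E * (expR (- l * r ^+ 2))%:E))%E.
    apply: eq_integral => r _.
    have e : \sum_(i <- s) set_coord j r w i ^+ 2 = \sum_(i <- s) w i ^+ 2.
      by apply: eq_big_seq => i si; rewrite /set_coord; case: eqP => // ij; rewrite -ij si in js.
    by rewrite -EFinM -expRD big_cons e {1}/set_coord eqxx mulrDr addrC.
  rewrite ge0_integralZl //.
  - by rewrite normal_laplace_sqr // muleC.
  - apply/measurableT_comp => //; apply: measurableT_comp => //.
    by apply: measurable_funM => //; exact: measurable_funX.
rewrite ge0_integralZl //.
by rewrite IH // -EFinM exprS.
Qed.

Lemma measure_le_integral (A : set (coords R I)) (f : coords R I -> \bar R) :
  measurable A -> measurable_fun setT f -> (forall w, (0 <= f w)%E) ->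
  (forall w, A w -> (1 <= f w)%E) -> (Q A <= \int[Q]_w f w)%E.
Proof.
move=> mA mf f0 f1.
have -> : Q A = (\int[Q]_w (\1_A w)%:E)%E by rewrite integral_indic // setIT.
apply: ge0_le_integral => //; first exact: measurable_coords_indic.
by move=> w _; rewrite indicE; case: (boolP (w \in A)) => //; rewrite inE => /f1.
Qed.

(** The origin of the constant 24 in the chi-square tail: [7 / 12 = 2 (1 / 4 + 1 / 24)]. By
    [exp (- x) >= 1 - x] at [x = 7 / 120], the tenth root of the left side is at most
    [120 / 113]. *)
Lemma expR_7_12_le2 : expR (7 / 12) <= 2 :> R.
Proof.
rewrite (_ : 7 / 12 = 10%:R * (7 / 120)); last by field.
rewrite expRM_natl; apply: (@le_trans _ _ ((120 / 113) ^+ 10)); last lra.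
rewrite lerXn2r ?nnegrE ?expR_ge0 ?divr_ge0 //.
rewrite -[X in expR X]opprK expRN -[leRHS]invrK lef_pV2 ?posrE ?expR_gt0 ?invr_gt0 ?divr_gt0 //.
by apply: le_trans (expR_ge1Dx _); lra.
Qed.

(** Exponential Markov inequality with parameter one half: the bound is [exp (n / 4) 2^(- n / 2)],
    and its comparison with [exp (- n / 24)] is an [n]-th power of [expR_7_12_le2] up to a square
    root. *)
Lemma chi_square_lower_tail (s : seq I) : uniq s ->
  (Q [set w : coords R I | (\sum_(j <- s) w j ^+ 2 < (size s)%:R / 2)%R] <=
    (expR (- ((size s)%:R / 24)))%:E)%E.
Proof.
move=> us; set n := size s.
have mS : measurable_fun setT (fun w : coords R I => \sum_(j <- s) w j ^+ 2).
  by apply: measurable_sum => i; apply: measurable_funX; exact: measurable_coord.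
apply: (@le_trans _ _ (\int[Q]_w ((expR (n%:R / 4))%:E * (expR (- (1 / 2) * \sum_(j <- s)
  w j ^+ 2))%:E))%E).
  apply: measure_le_integral.
  - rewrite -[X in measurable X]setTI; apply: (measurable_fun_ltr (f := fun w : coords R I =>
    _)) => //.
  - apply: measurable_funeM; apply/measurableT_comp => //; apply: measurableT_comp => //.
    exact: measurable_funM.
  - by move=> w; rewrite -EFinM lee_fin mulr_ge0 ?expR_ge0.
  - move=> w /= h; rewrite -EFinM -expRD lee_fin -[leLHS]expR0 ler_expR; lra.
rewrite ge0_integralZl //.
- rewrite expectation_expR_sqr // -EFinM lee_fin.
  rewrite (_ : 1 + 2 * (1 / 2) = 2); last by field.
  rewrite (_ : n%:R / 4 = n%:R * (1 / 4)); last by field.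
  rewrite (_ : - (n%:R / 24) = n%:R * (- (1 / 24))); last by field.
  rewrite !expRM_natl -exprMn lerXn2r ?nnegrE ?expR_ge0 ?mulr_ge0 ?expR_ge0 //.
  rewrite ler_pdivrMr ?sqrtr_gt0 // -ler_pdivrMl ?expR_gt0 // -expRN opprK -expRD.
  rewrite -(@ler_pXn2r _ 2) ?nnegrE ?expR_ge0 // sqr_sqrtr // -expRM_natl.
  by apply: le_trans expR_7_12_le2; rewrite ler_expR; lra.
- apply/measurableT_comp => //; apply: measurableT_comp => //.
  exact: measurable_funM.
Qed.

End gaussian_coordinates.

(** * Uniqueness of the Square-Root SLOPE minimizer *)

Section convex_line.
Context {R : realType}.

(* A point where the supporting slope [q] is strictly separated from both
   one-sided difference quotients is the unique minimizer of [g - q id]. *)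
Definition strict_slope (g : R -> R) (q t : R) : Prop :=
  forall k : nat, g t + q / k.+1%:R < g (t + k.+1%:R^-1) /\
                  g t - q / k.+1%:R < g (t - k.+1%:R^-1).

Lemma inv_succ_lt (h : R) : 0 < h -> exists k : nat, k.+1%:R^-1 < h.
Proof.
move=> h0; exists (Num.truncn h^-1); rewrite invf_plt ?posrE ?ltr0Sn //.
by rewrite truncnS_gt.
Qed.

(** The supporting lines with slopes [beta] extend the strict inequalities from the steps
    [1 / (k + 1)] to every nonzero step. Two distinct strict minimizers of [g - q id] would then
    each have the smaller value. *)
Lemma strict_slope_inj (g beta : R -> R) (q t1 t2 : R) :
  (forall t h, g t + h * beta t <= g (t + h)) ->
  strict_slope g q t1 -> strict_slope g q t2 -> t1 = t2.
Proof.
move=> gb.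
have H t : strict_slope g q t -> forall h, h != 0 -> g t + q * h < g (t + h).
  move=> st h h0; case: (ltP 0 h) => hpos.
    have [k kh] := inv_succ_lt h hpos; set x := k.+1%:R^-1 in kh.
    have x0 : 0 < x by rewrite invr_gt0.
    have [+ _] := st k; rewrite -/x => sx.
    have := gb (t + x) (- x); rewrite addrK => h1.
    have := gb (t + x) (h - x); rewrite (_ : t + x + (h - x) = t + h); last by ring.
    move=> h2.
    have bq : q < beta (t + x) by rewrite -(ltr_pM2l x0); lra.
    have : (h - x) * q < (h - x) * beta (t + x) by rewrite ltr_pM2l ?subr_gt0.
    lra.
  have {}hpos : 0 < - h by rewrite oppr_gt0 lt_neqAle h0.
  have [k kh] := inv_succ_lt (- h) hpos; set x := k.+1%:R^-1 in kh.
  have x0 : 0 < x by rewrite invr_gt0.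
  have [_ +] := st k; rewrite -/x => sx.
  have := gb (t - x) x; rewrite subrK => h1.
  have := gb (t - x) (h + x); rewrite (_ : t - x + (h + x) = t + h); last by ring.
  move=> h2.
  have bq : beta (t - x) < q by rewrite -(ltr_pM2l x0); lra.
  have : (- h - x) * beta (t - x) < (- h - x) * q by rewrite ltr_pM2l ?subr_gt0.
  lra.
move=> s1 s2; apply: contrapT => /eqP t12.
have := H _ s1 (t2 - t1); rewrite subr_eq0 eq_sym => /(_ t12).
have := H _ s2 (t1 - t2); rewrite subr_eq0 => /(_ t12).
rewrite !subrKC; lra.
Qed.

End convex_line.

(** * The objective: homogeneity, discretization and tilting *)

Section sqrt_slope.
Context {R : realType}.

Lemma enorm_ge0 m (v : 'cV[R]_m) : 0 <= enorm v.
Proof. exact: sqrtr_ge0. Qed.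

Lemma enormZ m (c : R) (v : 'cV[R]_m) : enorm (c *: v) = `|c| * enorm v.
Proof.
rewrite /enorm -sqrtr_sqr -sqrtrM ?sqr_ge0 //; congr Num.sqrt.
by rewrite mulr_sumr; apply: eq_bigr => k _; rewrite mxE exprMn.
Qed.

Lemma enorm_eq0 m (v : 'cV[R]_m) : enorm v = 0 -> v = 0.
Proof.
move=> /eqP; rewrite sqrtr_eq0 => v0; apply/colP => k; rewrite mxE.
have s0 : 0 <= \sum_(k < m) v k 0 ^+ 2 by apply: sumr_ge0 => ? _; exact: sqr_ge0.
have /eqP : \sum_(k < m) v k 0 ^+ 2 = 0 by apply: le_anti; rewrite v0 s0.
rewrite psumr_eq0; last by move=> i _; exact: sqr_ge0.
by move=> /allP /(_ k (mem_index_enum _)) /=; rewrite sqrf_eq0 => /eqP.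
Qed.

(** Nondecreasing maps commute with sorting. Used for scaling and for rounding to a grid. *)
Lemma sorted_abs_map p (f : R -> R) (b b' : 'cV[R]_p) :
  {homo f : x y / x <= y} -> (forall i, `|b' i 0| = f `|b i 0|) ->
  sorted_abs b' = map f (sorted_abs b).
Proof.
move=> fm fb; rewrite /sorted_abs.
have tot : total (fun x y : R => y <= x) by move=> x y; exact: le_total.
have tr : transitive (fun x y : R => y <= x) by move=> x y z xy yz; exact: le_trans yz xy.
have an : antisymmetric (fun x y : R => y <= x) by move=> x y /andP[h1 h2]; apply/le_anti/andP.
apply: (sorted_eq tr an).
- exact: sort_sorted.
- by rewrite (homo_sorted (e := fun x y : R => y <= x)) ?sort_sorted // => x y /fm.
- rewrite perm_sort (_ : [seq `|b' i 0| | i <- enum 'I_p] =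
  map f [seq `|b i 0| | i <- enum 'I_p]).
    by apply: perm_map; rewrite perm_sym perm_sort perm_refl.
  by elim: (enum _) => //= i l ->; rewrite fb.
Qed.

Lemma size_sorted_abs p (b : 'cV[R]_p) : size (sorted_abs b) = p.
Proof. by rewrite size_sort size_map size_enum_ord. Qed.

Lemma sorted_abs_ge0 p (b : 'cV[R]_p) j : 0 <= nth 0 (sorted_abs b) j.
Proof.
case: (ltnP j (size (sorted_abs b))) => [js|js]; last by rewrite nth_default.
have := mem_nth 0 js; rewrite mem_sort => /mapP[i _ ->]; exact: normr_ge0.
Qed.

Context (n1 p n : nat) (A : R) (n_gt0 : (0 < n)%N) (A_gt0 : 0 < A).

Local Notation obj := (@srslope_obj R A n n1 p).

Definition slope_pen (b : 'cV[R]_p) : R :=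
  \sum_(j < p) slope_lambda A n p j.+1 * nth 0 (sorted_abs b) j.

Lemma slope_lambda_gt0 (j : 'I_p) : 0 < slope_lambda A n p j.+1.
Proof.
rewrite mulr_gt0 // sqrtr_gt0 divr_gt0 ?ltr0n // ln_gt0 // ltr_pdivlMr ?ltr0n // mul1r ltr_nat.
by apply: leq_ltn_trans (ltn_ord j) _; rewrite -[X in (X < _)%N]mul1n ltn_pmul2r //
  (leq_ltn_trans _ (ltn_ord j)).
Qed.

Lemma slope_pen_ge0 b : 0 <= slope_pen b.
Proof.
apply: sumr_ge0 => j _; rewrite mulr_ge0 ?sorted_abs_ge0 // ltW //.
exact: slope_lambda_gt0.
Qed.

Lemma slope_pen_eq0 b : slope_pen b = 0 -> b = 0.
Proof.
move=> /eqP; rewrite psumr_eq0; last first.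
  by move=> j _; rewrite mulr_ge0 ?sorted_abs_ge0 // ltW // slope_lambda_gt0.
move=> /allP h; apply/colP => i; rewrite mxE; apply/eqP; rewrite -normr_eq0.
have : `|b i 0| \in sorted_abs b by rewrite mem_sort; apply/mapP; exists i => //;
  rewrite mem_enum.
move=> /(nthP 0)[j]; rewrite size_sorted_abs => jp <-.
have /= := h (Ordinal jp) (mem_index_enum _).
by rewrite mulf_eq0 gt_eqF ?(slope_lambda_gt0 (Ordinal jp)).
Qed.

Lemma slope_penZ c b : 0 <= c -> slope_pen (c *: b) = c * slope_pen b.
Proof.
move=> c0; rewrite /slope_pen mulr_sumr; apply: eq_bigr => j _.
rewrite (sorted_abs_map p (fun x => c * x) b).
- by rewrite (nth_map 0) ?size_sorted_abs // mulrCA.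
- by move=> x y; exact: ler_wpM2l.
- by move=> i; rewrite mxE normrM ger0_norm.
Qed.

Lemma srslope_objE (X : 'M[R]_(n1, p)) Y b :
  obj X Y b = enorm (Y - X *m b) / Num.sqrt n1%:R + 2 * slope_pen b.
Proof. by []. Qed.

Lemma srslope_obj_ge0 X Y b : 0 <= obj X Y b.
Proof.
by rewrite srslope_objE addr_ge0 ?mulr_ge0 ?invr_ge0 ?slope_pen_ge0 ?enorm_ge0 ?sqrtr_ge0.
Qed.

Lemma srslope_objZ X Y b c : 0 <= c -> obj X (c *: Y) (c *: b) = c * obj X Y b.
Proof.
move=> c0; rewrite !srslope_objE slope_penZ // -scalemxAr -scalerBr enormZ ger0_norm //.
by ring.
Qed.

Lemma srslope_obj_eq0 X Y b : obj X Y b = 0 -> b = 0 /\ Y = 0.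
Proof.
rewrite srslope_objE => h.
have h1 : 0 <= enorm (Y - X *m b) / Num.sqrt n1%:R by rewrite divr_ge0 ?enorm_ge0 ?sqrtr_ge0.
have h2 := slope_pen_ge0 b.
have b0 : b = 0 by apply: slope_pen_eq0; lra.
(* For [n1 = 0] the normalized residual is zero by the convention on division, but then [Y] has no
   entries. *)
split=> //; case: (posnP n1) => [n10|n1_gt0].
  by apply/colP => i; have := ltn_ord i; rewrite {2}n10.
have : enorm (Y - X *m b) / Num.sqrt n1%:R = 0 by lra.
have sn : Num.sqrt (n1%:R : R) != 0 by rewrite gt_eqF // sqrtr_gt0 ltr0n.
move/eqP; rewrite mulf_eq0 invr_eq0 (negbTE sn) orbF => /eqP.
by rewrite b0 mulmx0 subr0; exact: enorm_eq0.
Qed.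

(** Together these points form a countable set over which the infimum of the objective is the
    optimal value. *)
Definition grid (N : nat) (v : 'cV[int]_p) : 'cV[R]_p := \col_i ((v i 0)%:~R / N.+1%:R).

Lemma cvg_sumr (K : Type) (r : seq K) (u : K -> nat -> R) (l : K -> R) :
  (forall k, u k N @[N --> \oo] --> l k) ->
  (\sum_(k <- r) u k N) @[N --> \oo] --> \sum_(k <- r) l k.
Proof.
move=> ul; elim: r => [|k r IH].
  by rewrite big_nil; under eq_cvg do rewrite big_nil; exact: cvg_cst.
by rewrite big_cons; under eq_cvg do rewrite big_cons; exact: cvgD.
Qed.

Lemma cvg_enorm_residual (X : 'M[R]_(n1, p)) (Y : 'cV[R]_n1) (u : nat -> 'cV[R]_p)
  (b : 'cV[R]_p) :
  (forall i, u N i 0 @[N --> \oo] --> b i 0) ->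
  enorm (Y - X *m u N) @[N --> \oo] --> enorm (Y - X *m b).
Proof.
move=> ub; apply: (cvg_comp (fun N => \sum_(k < n1) ((Y - X *m u N) k 0) ^+ 2) (@Num.sqrt R));
  last exact: sqrt_continuous.
apply: cvg_sumr => k.
apply: (cvg_comp (fun N => (Y - X *m u N) k 0) (fun x : R => x ^+ 2));
  last exact: exprn_continuous.
under eq_cvg do rewrite !mxE; rewrite !mxE.
apply: cvgB; first exact: cvg_cst.
apply: cvg_sumr => i.
by apply: cvgM; [exact: cvg_cst|exact: ub].
Qed.

(** Coordinates are rounded towards zero, so the sorted moduli and the penalty do not increase. Only
    the residual needs a limit, and continuity of sorting is avoided. *)
Lemma srslope_obj_grid X Y b c : obj X Y b < c -> exists N v, obj X Y (grid N v) < c.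
Proof.
move=> hc.
pose rd N (x : R) : R := (Num.floor (N.+1%:R * x))%:~R / N.+1%:R.
pose v N : 'cV[int]_p := \col_i (sgz (b i 0) * Num.floor (N.+1%:R * `|b i 0|)).
have N0 N : (0 : R) < N.+1%:R by rewrite ltr0n.
have rd_le N x : rd N x <= x by rewrite ler_pdivrMr // mulrC floor_le.
have rd_gt N x : x - N.+1%:R^-1 <= rd N x.
  rewrite ler_pdivlMr // mulrBl mulVf ?gt_eqF // lerBlDr [x * _]mulrC.
  by have := floorD1_gt (N.+1%:R * x); rewrite intrD => /ltW.
have gridE N i : grid N (v N) i 0 = Num.sg (b i 0) * rd N `|b i 0|.
  by rewrite !mxE intrM -sgrEz mulrA.
have pen_le N : slope_pen (grid N (v N)) <= slope_pen b.
  apply: ler_sum => j _; rewrite ler_wpM2l ?(ltW (slope_lambda_gt0 j)) //.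
  rewrite (sorted_abs_map p (rd N) b).
  - by rewrite (nth_map 0) ?size_sorted_abs //.
  - move=> x y xy; rewrite ler_wpM2r ?invr_ge0 // ler_int le_floor // ler_wpM2l //.
  - move=> i; rewrite gridE normrM normr_sg.
    case: eqVneq => [->|_] /=; first by rewrite mul0r normr0 /rd mulr0 floor0 mul0r.
    rewrite mul1r ger0_norm // divr_ge0 // ler0z floor_ge0 mulr_ge0 //.
have gcvg i : grid N (v N) i 0 @[N --> \oo] --> b i 0.
  apply/cvgrPdist_le => e e0.
  have h := cvg_harmonic (R := R).
  near=> N.
  apply: (@le_trans _ _ N.+1%:R^-1).
    rewrite gridE [X in `|X - _|]numEsg -mulrBr normrM.
    apply: (@le_trans _ _ (1 * `| `|b i 0| - rd N `|b i 0| |)).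
      by rewrite ler_wpM2r // normr_sg; case: (_ != 0).
    by rewrite mul1r [leLHS]ger0_norm ?subr_ge0 // lerBlDl -lerBlDr.
  near: N.
  have /cvgrPdist_le /(_ _ e0) := h.
  by apply: filterS => N /=; rewrite sub0r normrN ger0_norm ?invr_ge0.
have := cvg_enorm_residual X Y (fun N => grid N (v N)) b gcvg.
move=> /(@cvgM _ _ _ _ _ (cst (Num.sqrt n1%:R)^-1) _ _) /(_ (cvg_cst _)).
move: hc; rewrite srslope_objE -ltrBrDr => hc.
move=> /(cvgr_lt _) /(_ _ hc) [N _ /(_ N (leqnn _)) /= hN].
exists N, (v N); rewrite srslope_objE; have := pen_le N; move: hN; rewrite /cst /=; lra.
Unshelve. all: by end_near.
Qed.

Section estimator.
Context (bh : 'M[R]_(n1, p) -> 'cV[R]_n1 -> 'cV[R]_p).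
Hypothesis bh_min : forall X Y b, obj X Y (bh X Y) <= obj X Y b.

Definition optval (X : 'M[R]_(n1, p)) (Y : 'cV[R]_n1) : R := obj X Y (bh X Y).

Lemma optval_ge0 X Y : 0 <= optval X Y. Proof. exact: srslope_obj_ge0. Qed.

Lemma optval_lt X Y c : optval X Y < c <-> exists N v, obj X Y (grid N v) < c.
Proof.
split; first exact: srslope_obj_grid.
by move=> [N [v h]]; apply: le_lt_trans h; exact: bh_min.
Qed.

Definition tilt (j : 'I_p) (X : 'M[R]_(n1, p)) (Y : 'cV[R]_n1) (t : R) : 'M[R]_(n1, p) :=
  \matrix_(k, l) (X k l + (if l == j then t * Y k 0 else 0)).

Lemma tilt_mul j X Y t b : tilt j X Y t *m b = X *m b + (t * b j 0) *: Y.
Proof.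
apply/colP => k; rewrite !mxE.
transitivity (\sum_l (X k l * b l 0 + (if l == j then t * b j 0 * Y k 0 else 0))).
  apply: eq_bigr => l _; rewrite !mxE mulrDl; congr (_ + _).
  by case: eqP => [->|_]; rewrite ?mul0r // mulrAC.
rewrite big_split /= -big_mkcond /= big_pred1_eq.
by [].
Qed.

Lemma tiltD j X Y s t : tilt j (tilt j X Y s) Y t = tilt j X Y (s + t).
Proof. by apply/matrixP => k l; rewrite !mxE -addrA; case: eqP; rewrite ?mulrDl ?addr0. Qed.

Lemma tilt0 j X Y : tilt j X Y 0 = X.
Proof. by apply/matrixP => k l; rewrite !mxE; case: eqP; rewrite ?mul0r addr0. Qed.

(* The residual is unchanged when [X], [Y] are replaced by
   [tilt j X Y t], [(1 + t b_j) Y]; homogeneity then rescales the response. *)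
Lemma optval_tilt j X Y t :
  optval (tilt j X Y t) Y * (1 + t * bh X Y j 0) <= optval X Y.
Proof.
set c := 1 + _; case: (ltP 0 c) => c0; last first.
  by apply: le_trans (optval_ge0 X Y); rewrite mulr_ge0_le0 // optval_ge0.
rewrite -ler_pdivlMr //.
apply: le_trans (bh_min _ _ (c^-1 *: bh X Y)) _.
rewrite (_ : obj _ Y _ = c^-1 * obj (tilt j X Y t) (c *: Y) (bh X Y)); last first.
  by rewrite -srslope_objZ ?invr_ge0 ?ltW // scalerA mulVf ?gt_eqF // scale1r.
rewrite mulrC ler_wpM2r ?invr_ge0 ?(ltW c0) // /optval !srslope_objE.
by rewrite tilt_mul /c scalerDl scale1r opprD addrACA subrr addr0.
Qed.

Definition tilt_inv (j : 'I_p) X Y (t : R) : R := (optval (tilt j X Y t) Y)^-1.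

(** Dividing [optval_tilt] by both optimal values exhibits a subgradient at [t], whence the
    convexity of the inverse value. If [Y = 0], all optimal values vanish and [0^-1 = 0] preserves
    the inequality. *)
Lemma tilt_inv_ge j X Y t h :
  tilt_inv j X Y t + h * (tilt_inv j X Y t * bh (tilt j X Y t) Y j 0) <= tilt_inv j X Y (t + h).
Proof.
have [->|Y0] := eqVneq Y 0.
  have e s : optval (tilt j X 0 s) 0 = 0.
    apply: le_anti; rewrite optval_ge0 andbT; apply: le_trans (bh_min _ _ 0) _.
    by have := srslope_objZ (tilt j X 0 s) 0 0 0 (lexx _); rewrite !scaler0 mul0r => ->.
  by rewrite /tilt_inv !e invr0 mul0r mulr0 addr0.
have V0 s : 0 < optval (tilt j X Y s) Y.
  rewrite lt_neqAle optval_ge0 andbT eq_sym; apply/eqP => /srslope_obj_eq0 [_ /eqP].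
  by rewrite (negbTE Y0).
have := optval_tilt j (tilt j X Y t) Y h; rewrite tiltD => H.
rewrite mulrA [h * _]mulrC -mulrA -[X in X + _]mulr1 -mulrDr /tilt_inv.
by rewrite -[leRHS]mul1r ler_pdivlMr // -mulrA ler_pdivrMl // mulr1 mulrC.
Qed.

(* If two minimizers differ in their [j]-th coordinate, [(X, Y)] is degenerate at every
   [q] strictly between the two coordinates multiplied by [tilt_inv j X Y 0]. *)
Definition degenerate (j : 'I_p) (q : R) (X : 'M[R]_(n1, p)) (Y : 'cV[R]_n1) : Prop :=
  strict_slope (tilt_inv j X Y) q 0.

(** Tilts compose additively, so degeneracy of the design tilted by [t] is a strict slope at [t] of
    one and the same convex function. *)
Lemma degenerate_inj j q X Y t1 t2 :
  degenerate j q (tilt j X Y t1) Y -> degenerate j q (tilt j X Y t2) Y -> t1 = t2.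
Proof.
have H t : degenerate j q (tilt j X Y t) Y -> strict_slope (tilt_inv j X Y) q t.
  by move=> h k; have := h k; rewrite /tilt_inv !tiltD addr0 add0r sub0r.
move=> /H h1 /H h2; apply: strict_slope_inj h1 h2.
by move=> t h; exact: (tilt_inv_ge j X Y t h).
Qed.

(** Without degeneracy, the coordinate is the right derivative of [tilt_inv] at zero divided by its
    value there, hence an infimum of difference quotients over the steps [1 / (k + 1)]. A vanishing
    optimal value forces a zero minimizer. *)
Lemma bh_lt j X Y (c : R) : (forall q : rat, ~ degenerate j (ratr q) X Y) ->
  bh X Y j 0 < c <->
  (optval X Y = 0 /\ 0 < c) \/ (optval X Y <> 0 /\
     exists k : nat, tilt_inv j X Y k.+1%:R^-1 < tilt_inv j X Y 0 * (1 + c / k.+1%:R)).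
Proof.
move=> ndeg; have [V0|Vn] := eqVneq (optval X Y) 0.
  have [b0 _] := srslope_obj_eq0 _ _ _ V0; rewrite b0 mxE.
  by split; [left|case=> [[]|[]]].
have gg h : tilt_inv j X Y 0 * (1 + h * bh X Y j 0) <= tilt_inv j X Y h.
  have := tilt_inv_ge j X Y 0 h; rewrite add0r tilt0; apply: le_trans.
  by rewrite mulrDr mulr1 lerD2l mulrCA.
have g0 : 0 < tilt_inv j X Y 0.
  by rewrite /tilt_inv tilt0 invr_gt0 lt_neqAle eq_sym Vn optval_ge0.
set g := tilt_inv j X Y in gg g0 *.
split; last first.
  case=> [[/eqP]|[_ [k hk]]]; first by rewrite (negbTE Vn).
  have := le_lt_trans (gg k.+1%:R^-1) hk; rewrite ltr_pM2l // ltrD2l mulrC ltr_pM2r // invr_gt0.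
move=> bc; right; split; first exact/eqP.
apply: contrapT => /forallNP hk.
have : g 0 * bh X Y j 0 < g 0 * c by rewrite ltr_pM2l.
(* If every quotient stayed above the level given by [c], this rational [q] would be a strict slope:
   the assumption separates it on the right, the subgradient on the left. *)
move=> /rat_in_itvoo [q]; rewrite in_itv /= => /andP[bq qc].
apply: (ndeg q) => k; rewrite -/g !add0r.
have k0 : (0 : R) < k.+1%:R^-1 by rewrite invr_gt0.
split.
  have /negP := hk k; rewrite -leNgt; apply: lt_le_trans.
  by rewrite mulrDr mulr1 ltrD2l mulrA ltr_pM2r.
apply: lt_le_trans (gg _).
by rewrite mulrDr mulr1 ltrD2l mulNr mulrN ltrN2 mulrCA [ratr q / _]mulrC ltr_pM2l.
Qed.

End estimator.
End sqrt_slope.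

(** * A Borel version of the estimator *)

Section measurable_matrices.
Context {R : realType} {d : measure_display} {T : measurableType d}.

Definition measurable_mx m k (M : T -> 'M[R]_(m, k)) : Prop :=
  forall i j, measurable_fun setT (fun w => M w i j).

Lemma measurable_mx_cst m k (M : 'M[R]_(m, k)) : measurable_mx m k (fun=> M).
Proof. by move=> i j; exact: measurable_cst. Qed.

Lemma measurable_mxD m k M N : measurable_mx m k M -> measurable_mx m k N ->
  measurable_mx m k (fun w => M w + N w).
Proof. by move=> hM hN i j; under eq_fun do rewrite mxE; exact: measurable_funD. Qed.

Lemma measurable_mxB m k M N : measurable_mx m k M -> measurable_mx m k N ->
  measurable_mx m k (fun w => M w - N w).
Proof. by move=> hM hN i j; under eq_fun do rewrite !mxE; exact: measurable_funB. Qed.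

Lemma measurable_mxZ m k (c : T -> R) M : measurable_fun setT c -> measurable_mx m k M ->
  measurable_mx m k (fun w => c w *: M w).
Proof. by move=> hc hM i j; under eq_fun do rewrite mxE; exact: measurable_funM. Qed.

Lemma measurable_mxM m k l M N : measurable_mx m k M -> measurable_mx k l N ->
  measurable_mx m l (fun w => M w *m N w).
Proof.
move=> hM hN i j; under eq_fun do rewrite mxE.
by apply: measurable_sum => r; exact: measurable_funM.
Qed.

Lemma measurable_enorm m (v : T -> 'cV[R]_m) :
  measurable_mx m 1 v -> measurable_fun setT (fun w => enorm (v w)).
Proof.
move=> hv; apply: (@measurableT_comp _ _ _ _ _ _ (@Num.sqrt R)).
  by apply: continuous_measurable_fun; exact: sqrt_continuous.
by apply: measurable_sum => k; apply: measurable_funX; exact: hv.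
Qed.

Lemma measurable_set_lt (f g : T -> R) : measurable_fun setT f -> measurable_fun setT g ->
  measurable [set w | f w < g w].
Proof.
move=> mf mg; rewrite -[X in measurable X]setTI.
by apply: (measurable_fun_ltr mf mg) => //.
Qed.

Lemma measurable_set_eq0 (f : T -> R) : measurable_fun setT f -> measurable [set w | f w = 0].
Proof.
by move=> mf; rewrite -[X in measurable X]setTI; exact: (mf measurableT _ (measurable_set1 0)).
Qed.

Lemma measurable_set_neqb (f : T -> bool) (e : bool) :
  measurable [set w | f w] -> measurable [set w | f w != e].
Proof.
move=> mf; case: e.
  rewrite (_ : [set w | _] = ~` [set w | f w]); first exact: measurableC.
  by apply/seteqP; split=> w /=; case: (f w).
by rewrite (_ : [set w | _] = [set w | f w]) //; apply/seteqP; split=> w /=; case: (f w).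
Qed.

Lemma measurable_fun_rays (f : T -> R) : (forall c, measurable [set w | f w < c]) ->
  measurable_fun setT f.
Proof.
move=> h mT; apply: (measurability _ (RGenInftyO.measurableE R)) => //.
move=> /= _ [_ [x ->] <-]; rewrite setTI.
by rewrite (_ : _ @^-1` _ = [set w | f w < x]) //; apply/seteqP; split=> w /=; rewrite in_itv.
Qed.

Lemma measurable_funV_ge0 (f : T -> R) : (forall w, 0 <= f w) ->
  measurable_fun setT f -> measurable_fun setT (fun w => (f w)^-1).
Proof.
move=> f0 mf; apply: measurable_fun_rays => c; case: (leP c 0) => c0.
  rewrite (_ : [set w | _] = set0) //; apply/seteqP; split=> w //= h.
  by have := lt_le_trans h c0; rewrite invr_lt0 ltNge f0.
rewrite (_ : [set w | _] = [set w | f w = 0] `|` [set w | c^-1 < f w]); last first.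
  apply/seteqP; split=> w /=; have := f0 w; rewrite le_eqVlt => /predU1P[fw|fw].
  - by left.
  - by right; rewrite invf_plt ?posrE.
  - by case=> _; rewrite -fw invr0.
  - by case=> [->|h]; [rewrite invr0|rewrite invf_plt ?posrE].
apply: measurableU; first exact: measurable_set_eq0.
by apply: measurable_set_lt => //; exact: measurable_cst.
Qed.

Context (n1 p n : nat) (A : R) (n_gt0 : (0 < n)%N) (A_gt0 : 0 < A).
Context (bh : 'M[R]_(n1, p) -> 'cV[R]_n1 -> 'cV[R]_p).
Hypothesis bh_min : forall X Y b, srslope_obj A n X Y (bh X Y) <= srslope_obj A n X Y b.
Context (X : T -> 'M[R]_(n1, p)) (Y : T -> 'cV[R]_n1).
Hypotheses (mX : measurable_mx n1 p X) (mY : measurable_mx n1 1 Y).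

Lemma measurable_optval (X' : T -> 'M[R]_(n1, p)) : measurable_mx n1 p X' ->
  measurable_fun setT (fun w => optval n1 p n A bh (X' w) (Y w)).
Proof.
move=> mX'; apply: measurable_fun_rays => c.
rewrite (_ : [set w | _] = \bigcup_N \bigcup_(v : 'cV[int]_p)
    [set w | srslope_obj A n (X' w) (Y w) (grid p N v) < c]); last first.
  apply/seteqP; split=> w /=.
    by move=> /(optval_lt _ _ _ _ n_gt0 A_gt0 _ bh_min)[N [v h]]; exists N => //; exists v.
  by move=> [N _ [v _ h]]; apply/(optval_lt _ _ _ _ n_gt0 A_gt0 _ bh_min); exists N, v.
apply: bigcup_measurable => N _; apply: countable_bigcupT_measurable.
  exact: countableP.
move=> v; apply: measurable_set_lt => //.
apply: measurable_funD => //; apply: measurable_funM => //.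
by apply: measurable_enorm; apply: measurable_mxB => //; apply: measurable_mxM => //;
  exact: measurable_mx_cst.
Qed.

Lemma measurable_tilt_inv j t :
  measurable_fun setT (fun w => tilt_inv n1 p n A bh j (X w) (Y w) t).
Proof.
apply: measurable_funV_ge0; first by move=> w; exact: optval_ge0.
apply: measurable_optval => k l; under eq_fun do rewrite mxE.
by apply: measurable_funD => //; case: eqP => _ //; apply: measurable_funM.
Qed.

Lemma measurable_degenerate j q :
  measurable [set w | degenerate n1 p n A bh j q (X w) (Y w)].
Proof.
rewrite (_ : [set w | _] = \bigcap_k (
  [set w | tilt_inv n1 p n A bh j (X w) (Y w) 0 + q / k.+1%:R <
           tilt_inv n1 p n A bh j (X w) (Y w) (0 + k.+1%:R^-1)] `&`
  [set w | tilt_inv n1 p n A bh j (X w) (Y w) 0 - q / k.+1%:R <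
           tilt_inv n1 p n A bh j (X w) (Y w) (0 - k.+1%:R^-1)])); last first.
  by apply/seteqP; split=> w h k; [move=> _; exact: h|exact: (h k Logic.I)].
apply: bigcap_measurableType => k _; apply: measurableI; apply: measurable_set_lt;
  do ?[exact: measurable_tilt_inv | apply: measurable_funD | apply: measurable_funB] => //;
  exact: measurable_tilt_inv.
Qed.

Definition degenerate_set : set T :=
  \bigcup_(j : 'I_p) \bigcup_(q : rat) [set w | degenerate n1 p n A bh j (ratr q) (X w) (Y w)].

Lemma measurable_degenerate_set : measurable degenerate_set.
Proof.
apply: countable_bigcupT_measurable; first exact: countableP.
move=> j; apply: countable_bigcupT_measurable; first exact: countableP.
by move=> q; exact: measurable_degenerate.
Qed.

(** Off the degenerate set, [bh_lt] writes the sublevel sets through countably many comparisons of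
    optimal values, which are measurable for any choice of minimizers. *)
Lemma measurable_bh_patch : measurable_mx p 1 (fun w =>
  if `[< degenerate_set w >] then 0 else bh (X w) (Y w)).
Proof.
move=> j i; apply: measurable_fun_rays => c; rewrite (ord1 i).
have mV := measurable_optval X mX.
rewrite (_ : [set w | _] = (degenerate_set `&` [set w | 0 < c]) `|`
  (~` degenerate_set `&` (
    ([set w | optval n1 p n A bh (X w) (Y w) = 0] `&` [set w | 0 < c]) `|`
    (~` [set w | optval n1 p n A bh (X w) (Y w) = 0] `&`
     \bigcup_k [set w | tilt_inv n1 p n A bh j (X w) (Y w) k.+1%:R^-1 <
        tilt_inv n1 p n A bh j (X w) (Y w) 0 * (1 + c / k.+1%:R)])))); last first.
  apply/seteqP; split=> w /=.
    case: asboolP => hw; first by rewrite mxE => h; left.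
    have nd q : ~ degenerate n1 p n A bh j (ratr q) (X w) (Y w).
      by move=> h; apply: hw; exists j => //; exists q.
    move=> /(bh_lt _ _ _ _ n_gt0 A_gt0 _ bh_min _ _ _ _ nd) h; right; split=> //.
    by case: h => [[? ?]|[? [k ?]]]; [left|right; split=> //; exists k].
  case=> [[hw c0]|[hw h]].
    by case: asboolP => // _; rewrite mxE.
  case: asboolP => // _.
  have nd q : ~ degenerate n1 p n A bh j (ratr q) (X w) (Y w).
    by move=> h'; apply: hw; exists j => //; exists q.
  apply/(bh_lt _ _ _ _ n_gt0 A_gt0 _ bh_min _ _ _ _ nd).
  by case: h => [[? ?]|[? [k _ ?]]]; [left|right; split=> //; exists k].
have mc : measurable [set w : T | 0 < c].
  by apply: measurable_set_lt => //; exact: measurable_cst.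
have mD := measurable_degenerate_set.
apply: measurableU; first exact: measurableI.
apply: measurableI; first exact: measurableC.
apply: measurableU; first by apply: measurableI => //; exact: measurable_set_eq0.
apply: measurableI; first by apply: measurableC; exact: measurable_set_eq0.
apply: bigcup_measurable => k _; apply: measurable_set_lt; first exact: measurable_tilt_inv.
by apply: measurable_funM => //; exact: measurable_tilt_inv.
Qed.

End measurable_matrices.

(** * Sections of measurable sets and Tonelli's theorem *)

Section fubini_sections.
Context {d1 d2 : measure_display} {T1 : measurableType d1} {T2 : measurableType d2}.
Context {R : realType} (m1 : probability T1 R) (m2 : probability T2 R).

Lemma measurable_section1 (D : set (T1 * T2)) x : measurable D -> measurable [set y | D (x, y)].
Proof.
move=> mD; rewrite (_ : [set y | _] = xsection D x); first exact: measurable_xsection.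
by apply/seteqP; split=> y; rewrite /xsection /= inE.
Qed.

Lemma measurable_section2 (D : set (T1 * T2)) y : measurable D -> measurable [set x | D (x, y)].
Proof.
move=> mD; rewrite (_ : [set x | _] = ysection D y); first exact: measurable_ysection.
by apply/seteqP; split=> x; rewrite /ysection /= inE.
Qed.

Lemma fubini_sections (D : set (T1 * T2)) : measurable D ->
  (\int[m1]_x m2 [set y | D (x, y)] = \int[m2]_y m1 [set x | D (x, y)])%E.
Proof.
move=> mD.
transitivity (\int[m1]_x \int[m2]_y (\1_D (x, y))%:E)%E.
  apply: eq_integral => x _; have mx := measurable_section1 D x mD.
  transitivity (\int[m2]_y (\1_[set y | D (x, y)] y)%:E)%E.
    by rewrite integral_indic // setIT.
  by apply: eq_integral => y _; rewrite !indicE; congr (_%:R%:E); rewrite /in_mem /= /mem /in_set.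
transitivity (\int[m2]_y \int[m1]_x (\1_D (x, y))%:E)%E.
  apply: (fubini_tonelli (m1 := m1) (m2 := m2) (fun z => (\1_D z)%:E)) => //.
  by apply/measurableT_comp => //; exact: measurable_indic.
apply: eq_integral => y _; have my := measurable_section2 D y mD.
transitivity (\int[m1]_x (\1_[set x | D (x, y)] x)%:E)%E; last first.
  by rewrite integral_indic // setIT.
by apply: eq_integral => x _; rewrite !indicE; congr (_%:R%:E); rewrite /in_mem /= /mem /in_set.
Qed.

Lemma measurable_fun_section1 (D : set (T1 * T2)) : measurable D ->
  measurable_fun setT (fun x => m2 [set y | D (x, y)]).
Proof.
move=> mD; rewrite (_ : (fun x => _) = m2 \o xsection D); first exact: measurable_fun_xsection.
apply/funext => x /=; congr (m2 _).
by apply/seteqP; split=> y; rewrite /xsection /= inE.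
Qed.

(** By Tonelli the set is null for the product, so almost every [x] has a null section; total mass
    one provides such an [x]. *)
Lemma null_section (D : set (T1 * T2)) : measurable D ->
  (forall y, m1 [set x | D (x, y)] = 0%E) -> exists x, m2 [set y | D (x, y)] = 0%E.
Proof.
move=> mD h; apply: contrapT => /forallNP hn.
have : (\int[m1]_x `|m2 [set y | D (x, y)]| = 0)%E.
  transitivity (\int[m1]_x m2 [set y | D (x, y)])%E.
    by apply: eq_integral => x _; rewrite gee0_abs ?measure_ge0.
  by rewrite fubini_sections //; apply: integral0_eq => y _; exact: h.
move/(ae_eq_integral_abs m1 measurableT (measurable_fun_section1 D mD)) => [N [mN N0 sN]].
have : m1 setT = 0%E.
  apply/eqP; rewrite eq_le measure_ge0 andbT -N0 le_measure ?inE //.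
  by move=> x _; apply: sN => /= /(_ Logic.I); exact: hn.
by have -> : m1 setT = 1%E by [exact: probability_setT]; move/eqP; rewrite onee_eq0.
Qed.

End fubini_sections.

Lemma negligible_bigcup_countable {d} {T : measurableType d} {R : realType}
    (mu : {measure set T -> \bar R}) (K : countType) (F : K -> set T) :
  (forall k, mu.-negligible (F k)) -> mu.-negligible (\bigcup_k F k).
Proof.
move=> hF; rewrite (_ : \bigcup_k F k = \bigcup_n (if unpickle n is Some k then F k else set0)).
  by apply: negligible_bigcup => n; case: unpickle => // ; exact: negligible_set0.
apply/seteqP; split=> w [].
  by move=> k _ Fk; exists (pickle k) => //; rewrite pickleK.
by move=> n _; case: unpickle => // k Fk; exists k.
Qed.

(** * Degenerate first subsamples have probability zero *)

Section sample.
Context {R : realType} (n1 n2 p : nat).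
Local Notation I := (('I_(n1 + n2) * 'I_p) + 'I_(n1 + n2))%type.
Local Notation coords := (coords R I).

Definition design (w : coords) : 'M[R]_(n1 + n2, p) := \matrix_(k, j) w (inl (k, j)).
Definition noise (w : coords) : 'cV[R]_(n1 + n2) := \col_k w (inr k).
Definition design1 (w : coords) : 'M[R]_(n1, p) := usubmx (design w).
Definition response1 (sigma : R) (b : 'cV[R]_p) (w : coords) : 'cV[R]_n1 :=
  usubmx (response sigma (design w) (noise w) b).

Definition row_index (k : I) : nat := match k with inl ij => ij.1 | inr i => i end.

Lemma measurable_design : measurable_mx _ _ design.
Proof. by move=> i j; under eq_fun do rewrite mxE; exact: measurable_coord. Qed.

Lemma measurable_noise : measurable_mx _ _ noise.
Proof. by move=> i j; under eq_fun do rewrite mxE; exact: measurable_coord. Qed.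

Lemma measurable_design1 : measurable_mx _ _ design1.
Proof. by move=> i j; under eq_fun do rewrite mxE; exact: measurable_design. Qed.

Lemma measurable_response sigma b :
  measurable_mx _ _ (fun w => response sigma (design w) (noise w) b).
Proof.
apply: measurable_mxD.
  by apply: measurable_mxM; [exact: measurable_design|exact: measurable_mx_cst].
by apply: measurable_mxZ => //; exact: measurable_noise.
Qed.

Lemma measurable_response1 sigma b : measurable_mx _ _ (response1 sigma b).
Proof. by move=> i j; under eq_fun do rewrite mxE; exact: measurable_response. Qed.

Lemma response1E sigma b w : response1 sigma b w = design1 w *m b + sigma *: usubmx (noise w).
Proof. by apply/colP => k; rewrite !mxE; congr (_ + _); apply: eq_bigr => j _; rewrite !mxE. Qed.

Context (Q : probability coords R) (hQ : iid_normal Q).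
Context (A : R) (n_gt0 : (0 < n1 + n2)%N) (A_gt0 : 0 < A).
Context (bh : 'M[R]_(n1, p) -> 'cV[R]_n1 -> 'cV[R]_p).
Hypothesis bh_min : forall X Y b,
  srslope_obj A (n1 + n2) X Y (bh X Y) <= srslope_obj A (n1 + n2) X Y b.
Context (sigma : R) (sigma_gt0 : 0 < sigma).

Local Notation deg := (degenerate n1 p (n1 + n2) A bh).

Let eps w := sigma *: usubmx (noise w).

Lemma measurable_eps : measurable_mx _ _ eps.
Proof.
apply: measurable_mxZ => // i j; under eq_fun do rewrite mxE; exact: measurable_noise.
Qed.

(** Adding [t] times the noise to column [j] moves the design along a line of tilts and leaves the
    noise alone. Each line meets the event in at most one point, so some translate of the event is
    null, and quasi-invariance returns to the event itself. *)
Lemma null_degenerate_noise j q : Q [set w | deg j q (design1 w) (eps w)] = 0%E.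
Proof.
set S := [set w | _].
have mS : measurable S.
  by apply: measurable_degenerate => //; [exact: measurable_design1|exact: measurable_eps].
pose J : {set I} := [set k : I | if k is inl ij then (ij.1 < n1)%N && (ij.2 == j) else false]%SET.
pose c (t : R) (k : I) (w : coords) : R := if k is inl ij then t * (sigma * w (inr ij.1)) else 0.
have mct t k : measurable_fun setT (c t k).
  rewrite /c; case: k => [ij|i] //.
  by do 2 (apply: measurable_funM => //); exact: measurable_coord.
have cJ t k (w w' : I -> R) : (forall i, i \notin J -> w i = w' i) -> c t k w = c t k w'.
  by move=> h; rewrite /c; case: k => [ij|i] //; rewrite h // inE.
have tiltE t w : design1 (translate J (c t) w) = tilt n1 p j (design1 w) (eps w) t.
  apply/matrixP => k l; rewrite !mxE /translate inE /= ltn_ord /=.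
  by case: eqP; rewrite ?addr0.
have epsE t w : eps (translate J (c t) w) = eps w.
  by apply/colP => k; rewrite !mxE /translate inE.
pose D := [set z : measurableTypeR R * coords | S (translate J (c z.1) z.2)].
have mD : measurable D.
  rewrite -[X in measurable X]setTI.
  suff mt : measurable_fun setT (fun z : measurableTypeR R * coords => translate J (c z.1) z.2).
    exact: mt.
  apply: measurable_fun_coords => k; rewrite /translate.
  have mk : measurable_fun setT (fun z : measurableTypeR R * coords => z.2 k).
    exact: (measurableT_comp (measurable_coord k) measurable_snd).
  case: (k \in J) => //; apply: measurable_funD => //; rewrite /c; case: k {mk} => [ij|i] //.
  apply: measurable_funM; first exact: measurable_fst.
  by apply: measurable_funM => //; exact: (measurableT_comp (measurable_coord _) measurable_snd).
(* The parameter is given a normal law because that law has no atoms. *)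
have [t Qt] : exists t, Q [set w | S (translate J (c t) w)] = 0%E.
  apply: (null_section (normal_prob (0 : R) 1) Q D mD) => w.
  apply: normal_prob_subsingleton; first exact: (measurable_section2 D w mD).
  move=> x y; rewrite /D /S /= !tiltE !epsE => hx hy.
  exact: (degenerate_inj _ _ _ _ n_gt0 A_gt0 _ bh_min _ _ _ _ _ _ hx hy).
have mSt : measurable [set w | S (translate J (c t) w)].
  by rewrite -[X in measurable X]setTI; exact: (measurable_translate J (c t) (mct t)).
(* The translation by [- t] is the inverse one, since the amounts depend only on noise coordinates,
   which do not move. *)
rewrite -[RHS](null_translate Q hQ J (c (- t)) _ (mct (- t)) (cJ (- t)) mSt Qt).
congr (Q _); apply: eq_set => w; rewrite /S /=.
suff -> : translate J (c t) (translate J (c (- t)) w) = w by [].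
apply/funext => k; rewrite /translate; case: (boolP (k \in J)) => kJ //.
rewrite (cJ t k _ w); last by move=> i /negbTE ->.
rewrite /c; case: k {kJ} => [ij|i]; last by rewrite !addr0.
by rewrite mulNr subrK.
Qed.

(** Translating the noise by [X b / sigma], an amount depending on the design only, reduces the
    event to the one with pure noise as response. *)
Lemma null_degenerate b j q : Q [set w | deg j q (design1 w) (response1 sigma b w)] = 0%E.
Proof.
pose J : {set I} := [set k : I | if k is inr i then true else false]%SET.
pose c (k : I) (w : coords) : R := if k is inr i then (design w *m b) i 0 / sigma else 0.
have mc k : measurable_fun setT (c k).
  rewrite /c; case: k => [ij|i] //; apply: measurable_funM => //.
  by apply: measurable_mxM; [exact: measurable_design|exact: measurable_mx_cst].
have cJ k (w w' : I -> R) : (forall i, i \notin J -> w i = w' i) -> c k w = c k w'.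
  move=> h; rewrite /c; case: k => [ij|i] //; congr (_ / _); rewrite !mxE.
  by apply: eq_bigr => l _; rewrite !mxE h // inE.
have mS : measurable [set w | deg j q (design1 w) (eps w)].
  by apply: measurable_degenerate => //; [exact: measurable_design1|exact: measurable_eps].
rewrite -[RHS](null_translate Q hQ J c _ mc cJ mS (null_degenerate_noise j q)).
congr (Q _); apply: eq_set => w.
have eX : design1 w = design1 (translate J c w).
  by apply/matrixP => k l; rewrite !mxE /translate inE.
have eY : response1 sigma b w = eps (translate J c w).
  apply/colP => k; rewrite response1E !mxE /translate inE /c mulrDr addrC; congr (_ + _).
  rewrite mulrC divfK ?gt_eqF // !mxE; apply: eq_bigr => l _.
  by rewrite !mxE.
by rewrite eX eY.
Qed.

Definition bad_sample b : set coords :=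
  degenerate_set n1 p (n1 + n2) A bh design1 (response1 sigma b).

Lemma null_bad_sample b : measurable (bad_sample b) /\ Q (bad_sample b) = 0%E.
Proof.
have mD j q : measurable [set w | deg j q (design1 w) (response1 sigma b w)].
  by apply: measurable_degenerate => //; [exact: measurable_design1|exact: measurable_response1].
split.
  by apply: measurable_degenerate_set => //; [exact: measurable_design1|exact:
    measurable_response1].
apply: measure_negligible.
  by apply: measurable_degenerate_set => //; [exact: measurable_design1|exact:
    measurable_response1].
apply: negligible_bigcup_countable => j; apply: negligible_bigcup_countable => q.
by exists [set w | deg j (ratr q) (design1 w) (response1 sigma b w)]; split => //;
  exact: null_degenerate.
Qed.

Lemma design1_dep (w w' : coords) : (forall k, (row_index k < n1)%N -> w k = w' k)
  -> design1 w = design1 w'.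
Proof. by move=> h; apply/matrixP => k l; rewrite !mxE h //=. Qed.

Lemma response1_dep b (w w' : coords) :
  (forall k, (row_index k < n1)%N -> w k = w' k) -> response1 sigma b w = response1 sigma b w'.
Proof.
move=> h; rewrite !response1E (design1_dep _ _ h); congr (_ + _ *: _).
by apply/colP => k; rewrite !mxE h //=.
Qed.

Definition patched_bh b (w : coords) : 'cV[R]_p :=
  if `[< bad_sample b w >] then 0 else bh (design1 w) (response1 sigma b w).

Lemma patched_bh_dep b (w w' : coords) :
  (forall k, (row_index k < n1)%N -> w k = w' k) -> patched_bh b w = patched_bh b w'.
Proof.
move=> h; rewrite /patched_bh /bad_sample /degenerate_set /bigcup /=.
by rewrite (design1_dep _ _ h) (response1_dep _ _ _ h).
Qed.

End sample.

(* [bh] is not assumed to be a Borel function, so its independence of the second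
   subsample is not automatic; almost sure uniqueness of the minimizer provides a Borel
   version [m] that depends on the first subsample only. *)
Lemma measurable_estimator {R : realType} (n1 n2 p : nat)
    (Q : probability (coords R (('I_(n1 + n2) * 'I_p) + 'I_(n1 + n2))%type) R)
    (A sigma : R) (bh : 'M[R]_(n1, p) -> 'cV[R]_n1 -> 'cV[R]_p) (b : 'cV[R]_p) :
  iid_normal Q -> 0 < A -> 0 < sigma ->
  (forall X Y b', srslope_obj A (n1 + n2) X Y (bh X Y) <= srslope_obj A (n1 + n2) X Y b') ->
  exists N (m : coords R (('I_(n1 + n2) * 'I_p) + 'I_(n1 + n2))%type -> 'cV[R]_p),
  [/\ measurable N, Q N = 0%E, measurable_mx _ _ m,
      forall w, ~ N w -> m w = bh (design1 n1 n2 p w) (response1 n1 n2 p sigma b w) &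
      forall w w', (forall k, (row_index n1 n2 p k < n1)%N -> w k = w' k) -> m w = m w'].
Proof.
move=> hQ A0 s0 hbh.
(* Without observations the weights [slope_lambda] vanish and uniqueness may fail, but the first
   subsample is then empty and [bh] is evaluated at a single point. *)
case: (posnP (n1 + n2)) => [n0|n_gt0].
  have n10 : n1 = 0%N by apply/eqP; move/eqP: n0; rewrite addn_eq0 => /andP[].
  exists set0, (fun=> bh 0 0); split; [exact: measurable0|exact: measure0|exact:
    measurable_mx_cst| |by []].
  move=> w _; congr (bh _ _); apply/matrixP => k; have := ltn_ord k; by rewrite {2}n10.
have [mN N0] := null_bad_sample n1 n2 p Q hQ A n_gt0 A0 bh hbh sigma s0 b.
exists (bad_sample n1 n2 p A bh sigma b), (patched_bh n1 n2 p A bh sigma b); split => //.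
- by apply: measurable_bh_patch => //; [exact: measurable_design1|exact: measurable_response1].
- by move=> w Nw; rewrite /patched_bh; case: asboolP.
- exact: patched_bh_dep.
Qed.

(** * Selection errors *)

Section merge_le.
Context {R : realType} {I : finType}.
Context (Q : probability (coords R I) R) (hQ : iid_normal Q).

Lemma measure_merge_le (J : {set I}) (B : set (coords R I)) (g : coords R I -> \bar R) :
  measurable B -> measurable_fun setT g ->
  (forall x, Q [set y | B (merge J x y)] <= g x)%E -> (Q B <= \int[Q]_x g x)%E.
Proof.
move=> mB mg h; rewrite (measure_merge Q hQ J) //; apply: ge0_le_integral => //.
- apply: (measurable_fun_section1 Q [set z | B (merge J z.1 z.2)]).
  by rewrite -[X in measurable X]setTI; exact: measurable_merge.
Qed.

Lemma merge_le_cst (J : {set I}) (B : set (coords R I)) (e : \bar R) :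
  measurable B -> (forall x, Q [set y | B (merge J x y)] <= e)%E -> (Q B <= e)%E.
Proof.
move=> mB h; apply: le_trans (measure_merge_le J B (fun=> e) mB _ h) _;
  first exact: measurable_cst.
have Q1 : Q setT = 1%E by exact: probability_setT.
rewrite integral_cst // le_eqVlt; apply/orP; left; apply/eqP.
exact: (etrans (congr1 (mule e) Q1) (mule1 e)).
Qed.

End merge_le.

Section selector_measurable.
Context {R : realType} {d : measure_display} {T : measurableType d}.

Lemma measurable_selector (a s' : R) (p s n2 : nat) (X : T -> 'M[R]_(n2, p))
    (Y : T -> 'cV[R]_n2) (c : T -> 'cV[R]_p) (i : 'I_p) : 0 <= a ->
  measurable_mx _ _ X -> measurable_mx _ _ Y -> measurable_mx _ _ c ->
  measurable [set w | selector a s' p s (X w) (Y w) (c w) i].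
Proof.
move=> a0 mX mY mc.
have mcol j : measurable_mx _ _ (fun w => col j (X w)).
  by move=> k l; under eq_fun do rewrite mxE; exact: mX.
have me := measurable_enorm _ _ (mcol i).
apply: measurable_set_lt.
  apply: measurable_funD.
    by apply: measurable_funM => //; apply: measurable_funM.
  apply: measurable_funM => //; apply: measurable_funV_ge0; last exact: measurable_funM.
  by move=> w; rewrite mulr_ge0 // enorm_ge0.
apply: measurable_funM; last by apply: measurable_funV_ge0 => // w; exact: enorm_ge0.
apply: (@measurableT_comp _ _ _ _ _ _ (@Num.norm R R)) => //.
have mr : measurable_mx _ _ (fun w => Y w - \sum_(j < p | j != i) c w j 0 *: col j (X w)).
  apply: measurable_mxB => // k l; under eq_fun do rewrite summxE big_mkcond /=.
  apply: measurable_sum => j; case: (j != i) => //; under eq_fun do rewrite mxE.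
  by apply: measurable_funM => //; exact: mcol.
under eq_fun do rewrite mxE; apply: measurable_sum => k; apply: measurable_funM => //.
by under eq_fun do rewrite mxE; exact: mcol.
Qed.

End selector_measurable.

(** * Error at one coordinate when the estimate is a fixed vector [c] *)

Section selection_error.
Context {R : realType} (n1 n2 p s : nat).
Local Notation I := (('I_(n1 + n2) * 'I_p) + 'I_(n1 + n2))%type.
Local Notation coords := (coords R I).
Context (Q : probability coords R) (hQ : iid_normal Q).
Context (sigma a delta : R) (b c : 'cV[R]_p) (i : 'I_p).
Hypotheses (sigma_gt0 : 0 < sigma) (a_gt0 : 0 < a) (delta_gt0 : 0 < delta).
Hypothesis hc : enorm (c - b) < delta * sigma.

Definition design2 (w : coords) : 'M[R]_(n2, p) := dsubmx (design n1 n2 p w).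
Definition response2 (w : coords) : 'cV[R]_n2 :=
  dsubmx (response sigma (design n1 n2 p w) (noise n1 n2 p w) b).

Lemma measurable_design2 : measurable_mx _ _ design2.
Proof. by move=> k j; under eq_fun do rewrite mxE; exact: measurable_design. Qed.

Lemma measurable_response2 : measurable_mx _ _ response2.
Proof. by move=> k j; under eq_fun do rewrite mxE; exact: measurable_response. Qed.

Let s' := sigma * Num.sqrt (1 + delta ^+ 2).
Let u (w : coords) : 'cV[R]_n2 := col i (design2 w).
Let L := ln (p%:R / s%:R - 1) : R.

Lemma inflated_noise_sqr : s' ^+ 2 = sigma ^+ 2 * (1 + delta ^+ 2).
Proof. by rewrite exprMn sqr_sqrtr // addr_ge0 // sqr_ge0. Qed.

Lemma inflated_noise_gt0 : 0 < s'.
Proof. by rewrite mulr_gt0 // sqrtr_gt0 ltr_wpDr // sqr_ge0. Qed.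

(* What remains of the working residual after removing the signal of column [i]. *)
Definition nuisance (y : coords) : 'cV[R]_n2 :=
  \sum_(j < p | j != i) (b j 0 - c j 0) *: col j (design2 y) + sigma *: dsubmx (noise n1 n2 p y).

Definition score (v : 'cV[R]_n2) (y : coords) : R := (v^T *m nuisance y) 0 0 / enorm v.

Lemma enorm_sqr m (v : 'cV[R]_m) : enorm v ^+ 2 = \sum_(k < m) v k 0 ^+ 2.
Proof. by rewrite sqr_sqrtr // sumr_ge0 // => k _; exact: sqr_ge0. Qed.

Definition own_column : {set I} :=
  [set k : I | if k is inl ij then ~~ (ij.1 < n1)%N && (ij.2 == i) else false]%SET.

Lemma response2E w k : response2 w k 0 =
  \sum_j w (inl (rshift n1 k, j)) * b j 0 + sigma * w (inr (rshift n1 k)).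
Proof. by rewrite !mxE; congr (_ + _); apply: eq_bigr => j _; rewrite !mxE. Qed.

Lemma nuisanceE y k : nuisance y k 0 =
  \sum_(j < p | j != i) (b j 0 - c j 0) * y (inl (rshift n1 k, j)) +
    sigma * y (inr (rshift n1 k)).
Proof.
by rewrite !mxE summxE; congr (_ + _); apply: eq_bigr => j _; rewrite !mxE.
Qed.

Lemma residual_merge x y : let w := merge own_column x y in
  (((u w)^T *m (response2 w - \sum_(j < p | j != i) c j 0 *: col j (design2 w))) 0 0)
    / enorm (u w) =
  b i 0 * enorm (u x) + score (u x) y.
Proof.
move=> w.
have rs (k : 'I_n2) : (rshift n1 k < n1)%N = false by rewrite /= ltnNge leq_addr.
have wi k : w (inl (rshift n1 k, i)) = x (inl (rshift n1 k, i)).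
  by rewrite /w /merge inE rs eqxx.
have wj k j : j != i -> w (inl (rshift n1 k, j)) = y (inl (rshift n1 k, j)).
  by move=> ji; rewrite /w /merge inE rs (negbTE ji).
have wr k : w (inr (rshift n1 k)) = y (inr (rshift n1 k)) by rewrite /w /merge inE.
have uE : u w = u x by apply/colP => k; rewrite !mxE wi.
have rE : response2 w - \sum_(j < p | j != i) c j 0 *: col j (design2 w) = b i 0 *: u x +
  nuisance y.
  apply/colP => k.
  have -> : (response2 w - \sum_(j < p | j != i) c j 0 *: col j (design2 w)) k 0 =
      response2 w k 0 - \sum_(j < p | j != i) c j 0 * w (inl (rshift n1 k, j)).
    by rewrite mxE [X in _ + X]mxE summxE; congr (_ - _); apply: eq_bigr => j _; rewrite !mxE.
  have -> : (b i 0 *: u x + nuisance y) k 0 = b i 0 * x (inl (rshift n1 k, i)) + nuisance y k 0.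
    by rewrite mxE; congr (_ + _); rewrite !mxE.
  rewrite response2E nuisanceE (bigD1 i) //= wi wr mulrC -!addrA; congr (_ + _).
  rewrite addrCA addrC; congr (_ + _); rewrite -sumrN -big_split /=; apply: eq_bigr => j ji.
  by rewrite wj //; ring.
rewrite uE rE mulmxDr -scalemxAr !mxE mulrDl; congr (_ + _).
  have [e0|e0] := eqVneq (enorm (u x)) 0; first by rewrite e0 invr0 !mulr0.
  rewrite (_ : \sum_j _ = enorm (u x) ^+ 2); first by rewrite expr2 mulrA mulfK.
  by rewrite enorm_sqr; apply: eq_bigr => k _; rewrite !mxE.
by rewrite /score mxE.
Qed.

(** Coefficients of [score v] as a linear form in all Gaussian coordinates. They vanish on the first
    subsample and on column [i]. *)
Definition score_coef (v : 'cV[R]_n2) (k : I) : R :=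
  match k with
  | inl ij => match fintype.split ij.1 with
     | inl _ => 0
     | inr r => if ij.2 == i then 0 else v r 0 / enorm v * (b ij.2 0 - c ij.2 0)
     end
  | inr l => match fintype.split l with inl _ => 0 | inr r => v r 0 / enorm v * sigma end
  end.

Lemma sum_second_half (F : I -> R) :
  (forall j (k : 'I_n1), F (inl (lshift n2 k, j)) = 0) ->
  (forall k : 'I_n1, F (inr (lshift n2 k)) = 0) ->
  \sum_k F k = \sum_(k < n2) (\sum_j F (inl (rshift n1 k, j)) + F (inr (rshift n1 k))).
Proof.
move=> F1 F2; rewrite big_sumType /= big_split /=; congr (_ + _).
  transitivity (\sum_k \sum_j F (inl (k, j))).
    by rewrite pair_bigA; apply: eq_bigr => -[].
  rewrite big_split_ord /= big1 ?add0r // => k _; rewrite big1 // => j _; exact: F1.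
by rewrite big_split_ord /= big1 ?add0r // => k _; exact: F2.
Qed.

Lemma split_lshift (k : 'I_n1) : fintype.split (lshift n2 k) = inl k.
Proof. exact: (unsplitK (inl k)). Qed.

Lemma split_rshift (k : 'I_n2) : fintype.split (rshift n1 k) = inr k.
Proof. exact: (unsplitK (inr k)). Qed.

Lemma scoreE v y : score v y = \sum_k score_coef v k * y k.
Proof.
rewrite sum_second_half; last 2 first.
- by move=> j k; rewrite /= split_lshift mul0r.
- by move=> k; rewrite /= split_lshift mul0r.
rewrite /score mxE mulr_suml; apply: eq_bigr => k _.
rewrite /= !split_rshift !mxE summxE mulrDr mulrDl; congr (_ + _); last by ring.
rewrite mulr_sumr mulr_suml big_mkcond /=; apply: eq_bigr => j _.
case: eqP => _ /=; first by rewrite mul0r.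
by rewrite !mxE; ring.
Qed.

Lemma measurable_score e v : measurable_fun setT (fun y => e * score v y).
Proof.
under eq_fun do rewrite scoreE; apply: measurable_funM => //; apply: measurable_sum => k.
by apply: measurable_funM => //; exact: measurable_coord.
Qed.

Lemma measurable_score_ge e v t : measurable [set y | t <= e * score v y].
Proof.
rewrite (_ : [set y | _] = ~` [set y | e * score v y < t]).
  apply: measurableC; apply: measurable_set_lt; last exact: measurable_cst.
  exact: measurable_score.
by apply/seteqP; split => y /=; rewrite leNgt => /negP.
Qed.

Let tau2 := sigma ^+ 2 + \sum_(j < p | j != i) (b j 0 - c j 0) ^+ 2.

Lemma score_coef_sqr v : enorm v != 0 -> \sum_k score_coef v k ^+ 2 = tau2.
Proof.
move=> v0; rewrite sum_second_half; last 2 first.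
- by move=> j k; rewrite /= split_lshift expr0n.
- by move=> k; rewrite /= split_lshift expr0n.
transitivity (\sum_(k < n2) v k 0 ^+ 2 / enorm v ^+ 2 * tau2).
  apply: eq_bigr => k _; rewrite /= !split_rshift mulrDr addrC; congr (_ + _).
    by rewrite exprMn expr_div_n.
  rewrite mulr_sumr [RHS]big_mkcond; apply: eq_bigr => j _ /=.
  by case: eqP => _ /=; rewrite ?expr0n // exprMn expr_div_n.
by rewrite -mulr_suml -mulr_suml -enorm_sqr divff ?mul1r // sqrf_eq0.
Qed.

Lemma tau2_le : tau2 <= s' ^+ 2.
Proof.
rewrite inflated_noise_sqr mulrDr mulr1 lerD2l.
apply: (@le_trans _ _ (enorm (c - b) ^+ 2)).
  rewrite enorm_sqr [leRHS](bigD1 i) //= ler_wpDl ?sqr_ge0 //.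
  by apply: ler_sum => j _; rewrite !mxE -sqrrN opprB.
rewrite [leRHS]mulrC -exprMn lerXn2r ?nnegrE ?enorm_ge0 ?mulr_ge0 ?(ltW hc) ?(ltW sigma_gt0)
  ?(ltW delta_gt0) //.
Qed.

(** The sign [e] covers both tails. The tail bound increases with the variance, so [tau2] may be
    replaced by [s' ^+ 2]. *)
Lemma score_tail v e t : enorm v != 0 -> e ^+ 2 = 1 -> 0 <= t ->
  (Q [set y | (t <= e * score v y)%R] <= (2^-1 * expR (- t ^+ 2 / (2 * s' ^+ 2)))%:E)%E.
Proof.
move=> v0 e1 t0.
have tau0 : 0 < tau2 by rewrite ltr_pwDl ?exprn_gt0 // sumr_ge0 // => j _; exact: sqr_ge0.
have sq : Num.sqrt tau2 ^+ 2 = \sum_k (e * score_coef v k) ^+ 2.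
  rewrite sqr_sqrtr ?(ltW tau0) // -(score_coef_sqr v v0); apply: eq_bigr => k _.
  by rewrite exprMn e1 mul1r.
have := lincomb_tail Q hQ (fun k => e * score_coef v k) (Num.sqrt tau2) t _ sq t0.
rewrite sqrtr_gt0 => /(_ tau0) h.
rewrite (_ : [set y | _] = [set w | t <= \sum_k e * score_coef v k * w k]); last first.
  by apply: eq_set => y; rewrite scoreE mulr_sumr; under eq_bigr do rewrite mulrA.
have s2 : 0 < s' ^+ 2 by rewrite exprn_gt0 // inflated_noise_gt0.
have t2 : 0 < Num.sqrt tau2 ^+ 2 by rewrite sqr_sqrtr // ltW.
apply: le_trans h _; rewrite lee_fin ler_wpM2l // ler_expR !mulNr lerN2.
rewrite ler_wpM2l ?sqr_ge0 // lef_pV2 ?posrE ?(mulr_gt0 _ s2) ?(mulr_gt0 _ t2) //.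
by rewrite ler_wpM2l // sqr_sqrtr ?tau2_le // ltW.
Qed.

Lemma own_column_merge x y : u (merge own_column x y) = u x.
Proof.
apply/colP => k; rewrite !mxE /merge inE.
by rewrite (_ : (rshift n1 k < n1)%N = false) ?eqxx //= ltnNge leq_addr.
Qed.

Lemma selector_merge x y : let w := merge own_column x y in
  selector a s' p s (design2 w) (response2 w) c i =
  (thr a s' p s (u x) < `|b i 0 * enorm (u x) + score (u x) y|).
Proof.
move=> w; rewrite /selector -/(u w) own_column_merge -residual_merge own_column_merge.
by rewrite normrM normfV (ger0_norm (enorm_ge0 _ _)).
Qed.

Lemma thr_eq0 (v : 'cV[R]_n2) : enorm v = 0 -> thr a s' p s v = 0.
Proof. by rewrite /thr => ->; rewrite !mulr0 mul0r invr0 mulr0 addr0. Qed.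

Definition own_rows : seq I := [seq inl (rshift n1 k, i) | k <- enum 'I_n2].

Lemma uniq_own_rows : uniq own_rows.
Proof.
by rewrite map_inj_uniq ?enum_uniq // => k l [] /addnI /val_inj.
Qed.

Lemma size_own_rows : size own_rows = n2.
Proof. by rewrite size_map size_enum_ord. Qed.

Definition own_sqnorm (w : coords) : R := \sum_(k <- own_rows) w k ^+ 2.

Lemma enorm_own_column_sqr x : enorm (u x) ^+ 2 = own_sqnorm x.
Proof.
by rewrite enorm_sqr /own_sqnorm big_map big_enum; apply: eq_bigr => k _; rewrite !mxE.
Qed.

Lemma measurable_own_sqnorm : measurable_fun setT own_sqnorm.
Proof. by apply: measurable_sum => k; apply: measurable_funX; exact: measurable_coord. Qed.

(** The Gaussian tail exponent at [a |u| / 2] is [l |u|^2], and [1 + 2 l] is the base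
    [1 + a^2 / (4 sigma^2 (1 + delta^2))] of the final rate. *)
Let l := a ^+ 2 / (8 * s' ^+ 2).
Let rho := (Num.sqrt (1 + 2 * l))^-1 ^+ n2.

Lemma laplace_rate_ge0 : 0 <= l.
Proof. by rewrite divr_ge0 ?sqr_ge0 // mulr_ge0 // sqr_ge0. Qed.

Lemma measurable_own_laplace k : measurable_fun setT (fun x : coords =>
  (k * expR (- l * own_sqnorm x))%:E).
Proof.
apply/measurableT_comp => //; apply: measurable_funM => //; apply: measurableT_comp => //.
by apply: measurable_funM => //; exact: measurable_own_sqnorm.
Qed.

Lemma integral_own_laplace k : 0 <= k ->
  (\int[Q]_x (k * expR (- l * own_sqnorm x))%:E = (k * rho)%:E)%E.
Proof.
move=> k0; have m1 := measurable_own_laplace 1.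
under eq_integral do rewrite EFinM.
rewrite ge0_integralZl //.
- by rewrite expectation_expR_sqr ?uniq_own_rows ?laplace_rate_ge0 // size_own_rows -EFinM.
- by apply: eq_measurable_fun m1 => x _; rewrite mul1r.
Qed.

(* The cross term of the square is [e * s' ^ 2 * L], which gives the factor
   [expR (- e * (L / 2))], with [e = 1] for [thr] and [e = - 1] for [a * E - thr]. *)
Lemma expR_thr_le (E : R) (e : R) : 0 < E ->
  expR (- (a * E / 2 + e * (s' ^+ 2 * L / (a * E))) ^+ 2 / (2 * s' ^+ 2)) <=
  expR (- e * (L / 2)) * expR (- l * E ^+ 2).
Proof.
move=> E0; have s0 := inflated_noise_gt0; rewrite -expRD ler_expR -subr_ge0.
rewrite (_ : _ - _ = e ^+ 2 * (s' * L / (a * E)) ^+ 2 / 2).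
  by rewrite divr_ge0 // mulr_ge0 ?sqr_ge0.
by rewrite /l; field; rewrite !gt_eqF.
Qed.

Lemma false_positive : b i 0 = 0 -> 0 <= L ->
  (Q [set w | selector a s' p s (design2 w) (response2 w) c i] <= (expR (- (L / 2)) * rho)%:E)%E.
Proof.
move=> bi L0; rewrite -integral_own_laplace ?expR_ge0 //.
have mX2 := measurable_design2.
have mY2 := measurable_response2.
apply: (measure_merge_le Q hQ own_column).
- by apply: measurable_selector => //; exact: ltW.
- exact: measurable_own_laplace.
move=> x.
rewrite (_ : [set y | _] = [set y | thr a s' p s (u x) < `|score (u x) y|]); last first.
  by apply: eq_set => y /=; rewrite selector_merge bi mul0r add0r.
(* A zero column is not selected: by the convention on division, threshold and statistic both
   vanish. *)
have [u0|u0] := eqVneq (enorm (u x)) 0.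
  rewrite (_ : [set y | _] = set0); first by rewrite measure0 lee_fin mulr_ge0 ?expR_ge0.
  apply/seteqP; split => y //=.
  by rewrite thr_eq0 // /score u0 invr0 mulr0 normr0 ltxx.
have E0 : 0 < enorm (u x) by rewrite lt_neqAle eq_sym u0 enorm_ge0.
set t := thr _ _ _ _ _.
have t0 : 0 <= t.
  have aE : 0 <= a * enorm (u x) by rewrite mulr_ge0 ?(ltW E0) ?(ltW a_gt0).
  rewrite /t /thr -/L; apply: addr_ge0; first exact: divr_ge0.
  by apply: divr_ge0 => //; apply: mulr_ge0 => //; exact: sqr_ge0.
apply: (@le_trans _ _ 
  (Q ([set y | t <= 1 * score (u x) y] `|` [set y | t <= -1 * score (u x) y]))).
  apply: le_measure; rewrite ?inE.
  - have -> : [set y | t < `|score (u x) y|] =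
        [set y | t < 1 * score (u x) y] `|` [set y | t < -1 * score (u x) y].
      apply/seteqP; split => y /=; rewrite mul1r mulN1r lter_normr; first by move=> /orP.
      by move=> h; apply/orP.
    by apply: measurableU; apply: measurable_set_lt;
      by [exact: measurable_score|exact: measurable_cst].
  - by apply: measurableU; exact: measurable_score_ge.
  - by move=> y /=; rewrite mul1r mulN1r lter_normr => /orP[] /ltW; [left|right].
apply: le_trans (measureU2 _ _ _) _; try exact: measurable_score_ge.
apply: le_trans (leeD (score_tail _ 1 t u0 _ t0) (score_tail _ (-1) t u0 _ t0)) _;
  rewrite ?expr1n ?sqrrN ?expr1n //.
(* The two one-sided tails, each of weight one half, give the constant one. *)
rewrite -EFinD lee_fin -mulrDl (_ : 2^-1 + 2^-1 = 1) ?mul1r; last by field.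
have := expR_thr_le (enorm (u x)) 1 E0.
by rewrite mul1r mulN1r enorm_own_column_sqr.
Qed.

Lemma false_negative : b i 0 != 0 -> a <= `|b i 0| -> 0 <= L -> (0 < n2)%N ->
  2 * s' ^+ 2 * L <= a ^+ 2 * (n2%:R / 2) ->
  (Q [set w | ~ selector a s' p s (design2 w) (response2 w) c i] <=
   (2^-1 * expR (L / 2) * rho + expR (- (n2%:R / 24)))%:E)%E.
Proof.
move=> bi abi L0 n20 hL.
have mX2 := measurable_design2.
have mY2 := measurable_response2.
pose small : set coords := [set w | own_sqnorm w < n2%:R / 2].
have msmall : measurable small.
  by apply: measurable_set_lt; [exact: measurable_own_sqnorm|exact: measurable_cst].
have k0 : 0 <= 2^-1 * expR (L / 2) by rewrite mulr_ge0 ?expR_ge0.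
apply: (@le_trans _ _ (\int[Q]_x ((2^-1 * expR (L / 2) * expR (- l * own_sqnorm x))%:E +
  (\1_small x)%:E))%E); last first.
  rewrite ge0_integralD //; last 2 first.
  - by apply: measurable_own_laplace.
  - by apply/measurableT_comp => //; exact: measurable_indic.
  rewrite integral_own_laplace // integral_indic // setIT EFinD leeD2l //.
  by have := chi_square_lower_tail Q hQ own_rows uniq_own_rows; rewrite size_own_rows.
apply: (measure_merge_le Q hQ own_column).
- by apply: measurableC; apply: measurable_selector => //; exact: ltW.
- apply: emeasurable_funD; first exact: measurable_own_laplace.
  by apply/measurableT_comp => //; exact: measurable_indic.
move=> x.
have mfn : measurable [set y | ~ selector a s' p s (design2 (merge own_column x y))
  (response2 (merge own_column x y)) c i].
  apply: (measurable_section1 [set z : coords * coords | ~ selector a s' p s (design2 (merge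
    own_column z.1 z.2)) (response2 (merge own_column z.1 z.2)) c i] x).
  rewrite -[X in measurable X]setTI.
  apply: (measurable_merge own_column measurableT [set w | ~ selector a s' p s (design2 w)
    (response2 w) c i]).
  by apply: measurableC; apply: measurable_selector => //; exact: ltW.
have g0 : 0 <= 2^-1 * expR (L / 2) * expR (- l * own_sqnorm x) by rewrite mulr_ge0 ?expR_ge0.
(* On [small] the threshold may exceed the signal, and the indicator supplies the trivial bound
   one. *)
case: (boolP (x \in small)) => xs.
  apply: (@le_trans _ _ 1%E); first exact: probability_le1.
  by rewrite indicE xs -EFinD lee_fin lerDr.
rewrite indicE (negbTE xs) adde0.
move: xs; rewrite notin_setE /small /= => /negP; rewrite -leNgt -enorm_own_column_sqr => xs.
have n2R : (0 : R) < n2%:R by rewrite ltr0n.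
have E0 : 0 < enorm (u x).
  rewrite lt_neqAle enorm_ge0 andbT eq_sym; apply/eqP => E0.
  by move: xs; rewrite E0 expr0n /= leNgt divr_gt0.
set t := a * enorm (u x) - thr a s' p s (u x).
have tE : t = a * enorm (u x) / 2 + -1 * (s' ^+ 2 * L / (a * enorm (u x))).
  by rewrite /t /thr -/L; lra.
have s0 : 0 < s' := inflated_noise_gt0.
(* Off [small], [hL] gives [2 s'^2 L <= a^2 |u|^2], which says that the threshold is at most
   [a |u|]. *)
have t0 : 0 <= t.
  rewrite tE mulN1r subr_ge0 ler_pdivrMr ?mulr_gt0 //.
  have : a ^+ 2 * (n2%:R / 2) <= a ^+ 2 * enorm (u x) ^+ 2 by rewrite ler_wpM2l ?sqr_ge0.
  by move: hL; rewrite !expr2; lra.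
(* A miss forces the score to oppose the sign of [b i 0] by at least [t]; a single tail suffices,
   hence the factor one half. *)
have e1 : (- Num.sg (b i 0)) ^+ 2 = 1 by rewrite sqrrN sqr_sg bi.
have E0' : enorm (u x) != 0 by rewrite gt_eqF.
apply: le_trans (le_trans _ (score_tail (u x) (- Num.sg (b i 0)) t E0' e1 t0)) _.
  apply: le_measure; rewrite ?inE //.
  - exact: measurable_score_ge.
  - move=> y /=; rewrite selector_merge => /negP; rewrite -leNgt => h.
    have h1 : Num.sg (b i 0) * (b i 0 * enorm (u x) + score (u x) y) <= thr a s' p s (u x).
      apply: le_trans h; apply: le_trans (ler_norm _) _.
      by rewrite normrM normr_sg bi mul1r.
    move: h1; rewrite mulrDr mulrA -normrEsg => h1.
    have : a * enorm (u x) <= `|b i 0| * enorm (u x) by rewrite ler_wpM2r ?enorm_ge0.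
    by rewrite /t mulNr; lra.
rewrite lee_fin -mulrA ler_wpM2l // tE.
have := expR_thr_le (enorm (u x)) (-1) E0.
by rewrite opprK mul1r.
Qed.

End selection_error.

Lemma card_pred_set (J : finType) (A : pred J) : #|[set i | A i]| = #|A|.
Proof. by apply: eq_card => i; apply/idP/idP; rewrite inE. Qed.

Section law.
Context {R : realType} {d d' : measure_display} {T : measurableType d} {T' : measurableType d'}.
Context (P : probability T R).

Lemma pushforward_probability (f : T -> T') : measurable_fun setT f ->
  exists Q : probability T' R, forall B, measurable B -> Q B = P (f @^-1` B).
Proof.
move=> mf.
pose mixin := isMeasurableFun.Build _ _ _ _ _ mf.
pose F : {mfun T >-> T'} := HB.pack f mixin.
by exists (distribution P F).
Qed.

Lemma le_measure_bigsetU (J : Type) (r : seq J) (F : J -> set T) :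
  (forall j, measurable (F j)) ->
  measurable (\big[setU/set0]_(j <- r) F j) /\
  (P (\big[setU/set0]_(j <- r) F j) <= \sum_(j <- r) P (F j))%E.
Proof.
move=> mF; elim: r => [|j r [IH1 IH2]]; first by rewrite !big_nil measure0.
rewrite !big_cons; split; first exact: measurableU.
by apply: le_trans (measureU2 _ _ _) _ => //; rewrite leeD2l.
Qed.

End law.

(** * Summation of the error bounds over the coordinates *)

Section error_bound.
Context {R : realType} (n1 n2 p s : nat).
Local Notation I := (('I_(n1 + n2) * 'I_p) + 'I_(n1 + n2))%type.
Local Notation coords := (coords R I).
Context (Q : probability coords R) (hQ : iid_normal Q).
Context (sigma a delta : R) (b : 'cV[R]_p).
Hypotheses (sigma_gt0 : 0 < sigma) (a_gt0 : 0 < a) (delta_gt0 : 0 < delta).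
Hypotheses (s_gt0 : (1 <= s)%N) (sp : (2 * s <= p)%N).
Hypothesis hb : Omega p s a b.

Let s' := sigma * Num.sqrt (1 + delta ^+ 2).
Let L := ln (p%:R / s%:R - 1) : R.
Let q := 1 + a ^+ 2 / (4 * sigma ^+ 2 * (1 + delta ^+ 2)).
Definition chernoff : R := expR (- (n2%:R / 2) * ln q).
(** The square root of the odds [(p - s) / s], as [L] is halved. *)
Definition odds : R := expR (L / 2).

Lemma sparsity_gt0 : (0 : R) < s%:R. Proof. by rewrite ltr0n. Qed.

Lemma sparsity_le_half : (s%:R : R) <= p%:R - s%:R.
Proof. by rewrite lerBrDr -natrD ler_nat addnn -mul2n. Qed.

Lemma odds_sqr : s%:R * odds ^+ 2 = p%:R - s%:R.
Proof.
have := sparsity_le_half; have := sparsity_gt0 => s0 sp'.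
rewrite /odds -expRM_natl (_ : 2%:R * (L / 2) = L) ?lnK ?posrE; last 2 first.
  by rewrite subr_gt0 ltr_pdivlMr // mul1r; lra.
  by field.
by rewrite mulrBr mulr1 mulrCA divff ?mulr1 // gt_eqF.
Qed.

Lemma log_odds_ge0 : 0 <= L.
Proof.
rewrite ln_ge0 // lerBrDr ler_pdivlMr ?sparsity_gt0 //; have := sparsity_le_half; lra.
Qed.

Lemma odds_ge1 : 1 <= odds.
Proof. by rewrite -[leLHS]expR0 ler_expR divr_ge0 // log_odds_ge0. Qed.

Lemma chernoff_base_gt1 : 1 < q.
Proof.
rewrite ltrDl divr_gt0 ?exprn_gt0 // mulr_gt0 ?mulr_gt0 ?exprn_gt0 //.
by rewrite ltr_wpDr // sqr_ge0.
Qed.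

Lemma chernoffE : (Num.sqrt (1 + 2 * (a ^+ 2 / (8 * s' ^+ 2))))^-1 ^+ n2 = chernoff.
Proof.
have q0 : 0 < q by apply: lt_trans chernoff_base_gt1.
have -> : 1 + 2 * (a ^+ 2 / (8 * s' ^+ 2)) = q.
  rewrite /s' inflated_noise_sqr /q; congr (1 + _); field.
  by rewrite !gt_eqF // ltr_wpDr // sqr_ge0.
have -> : Num.sqrt q = expR (ln q / 2).
  have -> : q = expR (ln q / 2) ^+ 2.
    by rewrite -expRM_natl (_ : 2%:R * (ln q / 2) = ln q) ?lnK //; field.
  by rewrite sqrtr_sqr ger0_norm ?expR_ge0 // -expRM_natl expRK; congr expR; field.
by rewrite -expRN -expRM_natl /chernoff; congr expR; field.
Qed.

(** Taking logarithms gives [L < n2 log q], and [log q <= q - 1 = a^2 / (4 s'^2)] turns this into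
    the condition under which the threshold stays below the signal. *)
Lemma odds_chernoff_lt1 : odds * chernoff < 1 ->
  (0 < n2)%N /\ 2 * s' ^+ 2 * L <= a ^+ 2 * (n2%:R / 2).
Proof.
rewrite -expRD expR_lt1 => h; split.
  rewrite lt0n; apply/eqP => n0; move: h; rewrite n0; have := log_odds_ge0; lra.
have s2 : 0 < s' ^+ 2 by rewrite exprn_gt0 // inflated_noise_gt0.
have lq : ln q <= a ^+ 2 / (4 * s' ^+ 2).
  have := ln_sublinear; rewrite /s' inflated_noise_sqr mulrA.
  have := expR_ge1Dx (a ^+ 2 / (4 * sigma ^+ 2 * (1 + delta ^+ 2))).
  by move=> h1 _; rewrite -[leRHS]expRK ler_ln ?posrE ?expR_gt0 // (lt_trans _ chernoff_base_gt1).
have : L <= n2%:R * (a ^+ 2 / (4 * s' ^+ 2)).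
  have : n2%:R * ln q <= n2%:R * (a ^+ 2 / (4 * s' ^+ 2)) by rewrite ler_wpM2l.
  lra.
move=> /(ler_wpM2l (ltW (mulr_gt0 (ltr0Sn R 1) s2))) /le_trans; apply.
by rewrite le_eqVlt; apply/orP; left; apply/eqP; field; rewrite gt_eqF // inflated_noise_gt0.
Qed.

Definition coord_bound (i : 'I_p) : R :=
  if b i 0 == 0 then odds^-1 * chernoff
  else if odds * chernoff < 1 then 2^-1 * odds * chernoff + expR (- (n2%:R / 24)) else 1.

Lemma coord_bound_ge0 i : 0 <= coord_bound i.
Proof.
rewrite /coord_bound; case: ifP => _; first by rewrite mulr_ge0 ?invr_ge0 ?expR_ge0.
by case: ifP => _ //; rewrite addr_ge0 ?mulr_ge0 ?expR_ge0.
Qed.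

Lemma fixed_error_le (c : 'cV[R]_p) i : enorm (c - b) < delta * sigma ->
  (Q [set w | (selector a s' p s (design2 n1 n2 p w) (response2 n1 n2 p sigma b w)
    c i != (b i 0 != 0))%R] <=
   (coord_bound i)%:E)%E.
Proof.
move=> hc; rewrite /coord_bound; case: eqVneq => bi.
  rewrite (_ : [set w | _] = [set w | selector a s' p s (design2 n1 n2 p w)
    (response2 n1 n2 p sigma b w) c i]); last first.
    by apply: eq_set => w; case: selector.
  have := false_positive n1 n2 p s Q hQ sigma a delta b c i sigma_gt0 a_gt0 delta_gt0 hc bi
    log_odds_ge0.
  by rewrite chernoffE expRN.
rewrite (_ : [set w | _] = [set w | ~ selector a s' p s (design2 n1 n2 p w)
  (response2 n1 n2 p sigma b w) c i]); last first.
  by apply/seteqP; split=> w /=; case: selector.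
case: ifP => h.
  have [n20 hL] := odds_chernoff_lt1 h.
  have := false_negative n1 n2 p s Q hQ sigma a delta b c i sigma_gt0 a_gt0 delta_gt0 hc bi
    (hb.2 i bi) log_odds_ge0 n20 hL.
  by rewrite chernoffE.
apply: probability_le1; apply: measurableC; apply: measurable_selector => //.
- exact: ltW.
- exact: measurable_design2.
- exact: measurable_response2.
Qed.

(* With [x = odds], so that [p = s (1 + x ^ 2)], everything reduces to
   [(s - r) / x <= (s - r) x] where [r] is the sparsity of [b]. *)
Lemma sum_coord_bound :
  \sum_i coord_bound i <= 2 * Num.sqrt (s%:R * (p - s)%:R) * chernoff +
    s%:R * expR (- (n2%:R / 24)).
Proof.
set r : R := (l0 b)%:R; set x := odds; set rho := chernoff; set eps := expR _.
have x1 : 1 <= x := odds_ge1.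
have x0 : 0 < x by apply: lt_le_trans x1.
have rho0 : 0 < rho by exact: expR_gt0.
have eps0 : 0 <= eps by exact: expR_ge0.
have rs : r <= s%:R by rewrite ler_nat; exact: hb.1.
have r0 : 0 <= r by [].
have sx : s%:R * x ^+ 2 = p%:R - s%:R := odds_sqr.
have -> : Num.sqrt (s%:R * (p - s)%:R) = s%:R * x :> R.
  rewrite natrB; last by apply: leq_trans sp; rewrite leq_pmull.
  by rewrite -sx mulrA -expr2 -exprMn sqrtr_sqr ger0_norm // mulr_ge0 // ltW.
pose one := if odds * chernoff < 1 then 2^-1 * odds * chernoff + expR (- (n2%:R / 24)) else 1.
have -> : \sum_i coord_bound i = (p%:R - r) * (x^-1 * rho) + r * one.
  rewrite (bigID (fun i => b i 0 != 0)) /= addrC; congr (_ + _).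
    rewrite (eq_bigr (fun=> x^-1 * rho)); last by move=> i /negPn bi; rewrite /coord_bound bi.
    rewrite sumr_const -[LHS]mulr_natl; congr (_ * _).
    have e : r + #|(fun i : 'I_p => ~~ (b i 0 != 0))|%:R = p%:R.
      rewrite -natrD; congr (_%:R); apply: etrans (etrans (cardC (fun i : 'I_p =>
        b i 0 != 0)) (card_ord p)).
      by rewrite /l0 card_pred_set.
    by rewrite -e addrC addKr.
  rewrite (eq_bigr (fun=> one)); last by move=> i /negbTE bi; rewrite /coord_bound bi.
  by rewrite sumr_const -[LHS]mulr_natl /r /l0 card_pred_set.
have key : (p%:R - r) * x^-1 + r * x <= 2 * (s%:R * x).
  rewrite -(ler_pM2r x0) mulrDl -mulrA mulVf ?gt_eqF // mulr1.
  have : (s%:R - r) * 1 <= (s%:R - r) * x ^+ 2.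
    by rewrite ler_wpM2l ?subr_ge0 // expr_ge1 // ltW.
  move: sx; rewrite !expr2 => sx; nra.
have key2 : ((p%:R - r) * x^-1 + r * x) * rho <= 2 * (s%:R * x) * rho by rewrite ler_wpM2r // ltW.
rewrite /one -/x -/rho; case: ltP => h.
  have e1 : r * eps <= s%:R * eps by rewrite ler_wpM2r.
  have e2 : 0 <= r * x * rho by rewrite !mulr_ge0 // ltW.
  rewrite -/eps; nra.
(* Here [x * rho >= 1], so the trivial bound one is absorbed into [x * rho]. *)
have e1 : r * 1 <= r * (x * rho) by rewrite ler_wpM2l.
have e2 : 0 <= s%:R * eps by rewrite mulr_ge0.
nra.
Qed.

End error_bound.

(** * Both subsamples together *)

Section sample_error.
Context {R : realType} (n1 n2 p s : nat).
Local Notation I := (('I_(n1 + n2) * 'I_p) + 'I_(n1 + n2))%type.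
Local Notation coords := (coords R I).
Context (Q : probability coords R) (hQ : iid_normal Q).
Context (sigma a delta : R) (b : 'cV[R]_p).
Hypotheses (sigma_gt0 : 0 < sigma) (a_gt0 : 0 < a) (delta_gt0 : 0 < delta).
Hypotheses (s_gt0 : (1 <= s)%N) (sp : (2 * s <= p)%N).
Hypothesis hb : Omega p s a b.
Context (m : coords -> 'cV[R]_p).
Hypothesis mm : measurable_mx _ _ m.
Hypothesis m_dep : forall w w' : coords,
  (forall k, (row_index n1 n2 p k < n1)%N -> w k = w' k) -> m w = m w'.

Let s' := sigma * Num.sqrt (1 + delta ^+ 2).

Definition sample_error (i : 'I_p) : set coords :=
  [set w | enorm (m w - b) < delta * sigma /\
     selector a s' p s (design2 n1 n2 p w) (response2 n1 n2 p sigma b w) (m w) i != (b i 0 != 0)].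

Lemma measurable_sample_error i : measurable (sample_error i).
Proof.
apply: measurableI.
  apply: measurable_set_lt; last exact: measurable_cst.
  by apply: measurable_enorm; apply: measurable_mxB => //; exact: measurable_mx_cst.
apply: measurable_set_neqb; apply: measurable_selector => //.
- exact: ltW.
- exact: measurable_design2.
- exact: measurable_response2.
Qed.

(** Freezing the first subsample freezes [m]. Either its value is close to [b] and [fixed_error_le]
    applies, or the conditional event is empty. *)
Lemma sample_error_le i : (Q (sample_error i) <= (coord_bound n2 p s sigma a delta b i)%:E)%E.
Proof.
pose J : {set I} := [set k : I | (row_index n1 n2 p k < n1)%N]%SET.
apply: (merge_le_cst Q hQ J); first exact: measurable_sample_error.
move=> x.
have mE y : m (merge J x y) = m x.
  by apply: m_dep => k kn; rewrite /merge inE kn.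
have rs (k : 'I_n2) : (rshift n1 k < n1)%N = false by rewrite /= ltnNge leq_addr.
have XE y : design2 n1 n2 p (merge J x y) = design2 n1 n2 p y.
  by apply/matrixP => k l; rewrite !mxE /merge inE /= rs.
have YE y : response2 n1 n2 p sigma b (merge J x y) = response2 n1 n2 p sigma b y.
  apply/colP => k; rewrite !response2E /merge inE /= rs; congr (_ + _).
  by apply: eq_bigr => j _; rewrite inE /= rs.
rewrite (_ : [set y | _] = [set y | enorm (m x - b) < delta * sigma /\
   selector a s' p s (design2 n1 n2 p y) (response2 n1 n2 p sigma b y) (m x)
     i != (b i 0 != 0)]); last first.
  by apply: eq_set => y; rewrite /sample_error /= mE XE YE.
case: (ltP (enorm (m x - b)) (delta * sigma)) => h.
  rewrite (_ : [set y | _] = [set y | selector a s' p s (design2 n1 n2 p y)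
    (response2 n1 n2 p sigma b y) (m x) i != (b i 0 != 0)]).
    exact: fixed_error_le.
  by apply/seteqP; split=> y /= => [[]|].
rewrite (_ : [set y | _] = set0); first by rewrite measure0 lee_fin coord_bound_ge0.
by apply/seteqP; split=> y //= -[].
Qed.

End sample_error.

Theorem theorem4 (R : realType) (d : measure_display) (T : measurableType d)
  (P : probability T R)
  (n1 n2 p s : nat) (sigma a delta A C0 C1 C2 : R)
  (X : T -> 'M[R]_(n1 + n2, p)) (xi : T -> 'cV[R]_(n1 + n2))
  (bh : 'M[R]_(n1, p) -> 'cV[R]_n1 -> 'cV[R]_p) :
  (* design and noise: all entries i.i.d. N(0,1), X independent of xi *)
  std_gaussian_design P X xi ->
  0 < sigma ->
  (* bh is a Square-Root SLOPE estimator (any minimizer) with A >= 16 + 4 sqrt 2 *)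
  16 + 4 * Num.sqrt 2 <= A ->
  (forall (X1 : 'M[R]_(n1, p)) (Y1 : 'cV[R]_n1) (b : 'cV[R]_p),
      srslope_obj A (n1 + n2) X1 Y1 (bh X1 Y1) <= srslope_obj A (n1 + n2) X1 Y1 b) ->
  (* bh, applied to the first subsample, is a statistic (measurable) *)
  (forall (b : 'cV[R]_p) (i : 'I_p),
      measurable_fun setT (fun w =>
        bh (usubmx (X w)) (usubmx (response sigma (X w) (xi w) b)) i 0)) ->
  (* C0, C1, C2 are the constants of the Square-Root SLOPE accuracy fact *)
  (forall delta' : R, 0 < delta' <= 1 ->
     n1%:R > C0 / delta' ^+ 2 * s%:R * ln (expR 1 * p%:R / s%:R) ->
     forall b : 'cV[R]_p, (l0 b <= s)%N ->
       (P [set w | (delta' * sigma <=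
                  enorm (bh (usubmx (X w)) (usubmx (response sigma (X w) (xi w) b)) - b))%R]
        <= (C1 * (s%:R / (2 * p%:R)) `^ (C2 * s%:R))%:E)%E) ->
  (* assumptions of the theorem *)
  (1 <= s)%N -> (2 * s <= p)%N ->
  0 < a -> a <= sigma -> 0 < delta <= 1 ->
  n1%:R > C0 / delta ^+ 2 * s%:R * ln (expR 1 * p%:R / s%:R) ->
  n2%:R >= 4 * sigma ^+ 2 * ln (p%:R / s%:R - 1) / a ^+ 2 ->
  let sigma' := sigma * Num.sqrt (1 + delta ^+ 2) in
  let etahat (b : 'cV[R]_p) (w : T) : 'I_p -> bool :=
    let Y := response sigma (X w) (xi w) b in
    selector a sigma' p s (dsubmx (X w)) (dsubmx Y)
      (bh (usubmx (X w)) (usubmx Y)) in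
  let common := 2 * Num.sqrt (s%:R * (p - s)%:R) *
      expR (- (n2%:R / 2) * ln (1 + a ^+ 2 / (4 * sigma ^+ 2 * (1 + delta ^+ 2))))
      + s%:R * expR (- (n2%:R / 24)) in
  (forall b : 'cV[R]_p, b \in Omega p s a ->
     (\int[P]_w ((hamming (etahat b w) (support_ind b))%:R)%:E
      <= (common + C1 * p%:R * (s%:R / (2 * p%:R)) `^ (C2 * s%:R))%:E)%E) /\
  (forall b : 'cV[R]_p, b \in Omega p s a ->
     (P [set w | etahat b w <> support_ind b]
      <= (common + C1 * (s%:R / (2 * p%:R)) `^ (C2 * s%:R))%:E)%E).
Proof.
move=> [[mZ indep] law] sigma0 hA bh_min mbh acc s1 sp a0 _ /[dup] hdelta /andP[delta0 _] hn1 _.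
move=> sigma' etahat common.
pose I := (('I_(n1 + n2) * 'I_p) + 'I_(n1 + n2))%type.
(* The whole sample becomes one point of the coordinate space, whose law [Q] carries the product
   arguments. *)
pose Z w : coords R I := fun k => gauss_entries X xi k w.
have mZ' : measurable_fun setT Z by exact: measurable_fun_coords.
have [Q QE] := pushforward_probability P Z mZ'.
have hQ : iid_normal Q.
  move=> B mB; rewrite QE; last exact: measurable_box.
  rewrite (_ : Z @^-1` box B = \bigcap_(i in [set i | i \in [set: I]%SET])
    (gauss_entries X xi i @^-1` B i)).
    rewrite indep //; apply: eq_big => k; [by rewrite inE|move=> _; exact: law].
  by apply/seteqP; split=> w h k; [move=> _; exact: h|exact: (h k (finset.in_setT _))].
have designE w : design n1 n2 p (Z w) = X w by apply/matrixP => i j; rewrite mxE.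
have noiseE w : noise n1 n2 p (Z w) = xi w by apply/colP => i; rewrite mxE.
have A0 : 0 < A by apply: lt_le_trans hA; rewrite ltr_pwDl // mulr_ge0 // sqrtr_ge0.
pose est b w := bh (usubmx (X w)) (usubmx (response sigma (X w) (xi w) b)).
pose kappa := C1 * (s%:R / (2 * p%:R)) `^ (C2 * s%:R).
pose far b := [set w | delta * sigma <= enorm (est b w - b)].
pose err b i := [set w | etahat b w i != support_ind b i].
pose bnd b i := coord_bound n2 p s sigma a delta b i.
have mX : measurable_mx _ _ X by move=> i j; exact: (mZ (inl (i, j))).
have mxi : measurable_mx _ _ xi by move=> i j; rewrite (ord1 j); exact: (mZ (inr i)).
have mest b : measurable_mx _ _ (est b) by move=> i j; rewrite (ord1 j); exact: mbh.
have mresp b : measurable_mx _ _ (fun w => response sigma (X w) (xi w) b).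
  apply: measurable_mxD; last exact: measurable_mxZ.
  by apply: measurable_mxM => //; exact: measurable_mx_cst.
have mfar b : measurable (far b).
  rewrite (_ : far b = ~` [set w | enorm (est b w - b) < delta * sigma]).
    apply: measurableC; apply: measurable_set_lt; last exact: measurable_cst.
    by apply: measurable_enorm; apply: measurable_mxB => //; exact: measurable_mx_cst.
  by rewrite /far; apply/seteqP; split=> w /=; rewrite leNgt => /negP.
have merr b i : measurable (err b i).
  apply: measurable_set_neqb; apply: measurable_selector => //; first exact: ltW.
  - by move=> k j; under eq_fun do rewrite mxE; exact: mX.
  - by move=> k j; under eq_fun do rewrite mxE; exact: mresp.
  - exact: mest.
have farP b : Omega p s a b -> (P (far b) <= kappa%:E)%E.
  by move=> hb; exact: (acc _ hdelta hn1 b hb.1).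
(* Off [far b] and the null set [N], the estimate equals its Borel version and is close to [b], so
   the error is a [sample_error]. *)
have errP b i : Omega p s a b -> (P (err b i `\` far b) <= (bnd b i)%:E)%E.
  move=> hb.
  have [N [m [mN N0 mm mE m_dep]]] := measurable_estimator n1 n2 p Q A sigma bh b hQ A0 sigma0
    bh_min.
  have mF := measurable_sample_error n1 n2 p s sigma a delta b a0 m mm i.
  set F := sample_error _ _ _ _ _ _ _ _ _ _ in mF.
  apply: (@le_trans _ _ (P (Z @^-1` (N `|` F)))).
    apply: le_measure; rewrite ?inE.
    - exact: measurableD.
    - by rewrite -[X in measurable X]setTI; apply: mZ' => //; exact: measurableU.
    move=> w [/= e /negP]; rewrite -ltNge => nf.
    have [Nw|Nw] := pselect (N (Z w)); first by left.
    right; rewrite /F /sample_error /= mE // /design1 /response1 /design2 /response2 designE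
      noiseE.
    by split.
  rewrite -QE; last exact: measurableU.
  apply: le_trans (measureU2 _ mN mF) _.
  rewrite [X in (X + _)%E]N0 add0e.
  exact: sample_error_le.
have sumP b : Omega p s a b -> (\sum_(i < p) P (err b i `\` far b) <= common%:E)%E.
  move=> hb; apply: (@le_trans _ _ (\sum_(i < p) (bnd b i)%:E)%E).
    by apply: lee_sum => i _; exact: errP.
  by rewrite sumEFin lee_fin; exact: sum_coord_bound.
(* In expectation each of the [p] coordinates pays for [far b]; this is the factor [p] of the first
   bound. *)
have kappa0 b : Omega p s a b -> (\sum_(i < p) P (err b i) <= (common + p%:R * kappa)%:E)%E.
  move=> hb; apply: (@le_trans _ _ (\sum_(i < p) (P (err b i `\` far b) + kappa%:E))%E).
    apply: lee_sum => i _.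
    have mD : measurable (err b i `\` far b) by exact: measurableD.
    apply: (@le_trans _ _ (P ((err b i `\` far b) `|` far b))).
      apply: le_measure; rewrite ?inE //; first exact: measurableU.
      by move=> w ew; have [fw|fw] := pselect (far b w); [right|left].
    by apply: le_trans (measureU2 _ mD (mfar b)) _; rewrite leeD2l // farP.
  rewrite big_split /= EFinD leeD ?sumP // sumEFin lee_fin sumr_const card_ord.
  by rewrite -[leLHS]mulr_natl.
split=> b; rewrite inE => hb.
- have -> : C1 * p%:R * (s%:R / (2 * p%:R)) `^ (C2 * s%:R) = p%:R * kappa.
    by rewrite /kappa mulrAC mulrC mulrA.
  apply: le_trans (kappa0 b hb).
  rewrite (eq_integral (fun w => \sum_(i < p) (\1_(err b i) w)%:E)%E); last first.
    move=> w _; rewrite sumEFin; congr EFin; rewrite /hamming card_pred_set -sum1_card natr_sum.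
    rewrite big_mkcond; apply: eq_bigr => i _; rewrite indicE.
    rewrite (_ : (w \in err b i) = (etahat b w i != support_ind b i)).
      by rewrite -[i \in _]/(etahat b w i != support_ind b i); case: (_ != _).
    by apply/idP/idP; rewrite inE.
  rewrite ge0_integral_sum //.
  + by apply: lee_sum => i _; rewrite integral_indic // setIT.
  + by move=> i; apply/measurableT_comp => //; exact: measurable_indic.
- have E : [set w | etahat b w <> support_ind b] = \big[setU/set0]_(i < p) err b i.
    rewrite -bigcup_seq; apply/seteqP; split=> w /=.
      move=> h; apply: contrapT => hn; apply: h; apply/funext => i; apply: contrapT => /eqP hi.
      by apply: hn; exists i => //=; rewrite mem_index_enum.
    by move=> [i _ /eqP hi] h; apply: hi; rewrite h.
  have [mE _] := le_measure_bigsetU P 'I_p (index_enum _) (err b) (merr b).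
  have mDf i : measurable (err b i `\` far b) by exact: measurableD.
  have [mU hU] := le_measure_bigsetU P 'I_p (index_enum _) (fun i => err b i `\` far b) mDf.
  (* The union bound covers only the errors off [far b], so this event is paid for once. *)
  apply: (@le_trans _ _ (P (\big[setU/set0]_(i < p) (err b i `\` far b) `|` far b))).
    apply: le_measure; rewrite ?inE ?E //; first exact: measurableU.
    rewrite -!bigcup_seq => w [i hi ew].
    by have [fw|fw] := pselect (far b w); [right|left; exists i].
  apply: le_trans (measureU2 _ mU (mfar b)) _.
  by rewrite EFinD leeD ?farP //; apply: le_trans hU _; exact: sumP.
Qed.
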